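(* Let $(M,\tau)$ be a tracial von Neumann algebra and suppose \[ \delta\colon \operatorname{dom}(\delta)\to [L^2(M,\tau)\otimes L^2(M,\tau)]^{\oplus\infty} \] is a derivation whose domain $\operatorname{dom}(\delta)\subset M$ is a unital $*$-subalgebra. Let $Q,N\leq M$ be the von Neumann subalgebras generated by $\ker(\delta)\cap\ker(\delta)^*$ and $\operatorname{dom}(\delta)$, respectively, where $\ker(\delta)^*:=\{x^* : x\in\ker(\delta)\}$. If $\delta$ is closable as a densely defined operator on $L^2(N,\tau)$, then the anticoarse space $L^2_{\mathrm{ac}}(Q\leq N,\tau)$ for $Q\leq N$ satisfies \[ L^2_{\mathrm{ac}}(Q\leq N,\tau)\subset \ker(\bar\delta), \] where $\bar\delta$ denotes the closure of $\delta$.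
   Context: A tracial von Neumann algebra $(M,\tau)$ is a von Neumann algebra with a faithful normal tracial state $\tau$; $L^2(M,\tau)$ is the associated GNS Hilbert space, and for a von Neumann subalgebra $N\leq M$, $L^2(N,\tau)\subset L^2(M,\tau)$ is the closure of $N$. The space $L^2(M,\tau)\otimes L^2(M,\tau)$ is the Hilbert space tensor product with $M$-$M$-bimodule structure determined by $a\cdot(\xi\otimes\eta)\cdot b=(a\xi)\otimes(\eta b)$ for $a,b\in M$ (and analogously for $Q$ in place of $M$), and $[\,\cdot\,]^{\oplus\infty}$ denotes the Hilbert space direct sum of countably infinitely many copies, with entrywise bimodule structure. A derivation is a linear map $\delta$ on $\operatorname{dom}(\delta)$ with $\delta(xy)=\delta(x)\cdot y+x\cdot\delta(y)$. For an inclusion $Q\leq N$ of von Neumann algebras with faithful normal tracial state $\tau$ on $N$, the anticoarse space is \[ L^2_{\mathrm{ac}}(Q\leq N,\tau):=\bigcap\left\{\ker T : T\in \mathrm{Hom}_{Q-Q}\big(L^2(N,\tau),\,L^2(Q,\tau)\otimes L^2(Q,\tau)\big)\right\}, \] where $\mathrm{Hom}_{Q-Q}$ denotes the space of bounded linear $Q$-$Q$-bimodular maps. *)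

(* Defs.v *)
From HB Require Import structures.
From mathcomp Require Import all_boot all_order all_algebra.
From mathcomp Require Import sesquilinear complex.
From mathcomp Require Import all_classical all_reals all_analysis.

Set Implicit Arguments.
Unset Strict Implicit.
Unset Printing Implicit Defensive.

Import Order.TTheory GRing.Theory Num.Theory.
Import numFieldNormedType.Exports.

Local Open Scope classical_set_scope.
Local Open Scope ring_scope.

(* The inner product is linear in its first argument and conjugate-linear in
   its second one. *)
HB.mixin Record isHilbert (R : realType) H of CompleteNormedModule R[i] H := {
  hdot : {dot H for (@Num.conj R[i])} ;
  hdot_norm : forall u : H, `|u| ^+ 2 = hdot u u
}.

#[short(type="hilbertType")]
HB.structure Definition Hilbert (R : realType) :=
  {H of isHilbert R H & CompleteNormedModule R[i] H}.

Definition square_summable (R : realType) (H : hilbertType R) (u : nat -> H) :=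
  cvgn (series (fun n => `|u n| ^+ 2 : R[i]^o)).

Definition bounded_op (R : realType) (H K : hilbertType R) : set (H -> K) :=
  [set x | linear x /\ continuous x].

(* y = x^* *)
Definition adjoint (R : realType) (H : hilbertType R) (x y : H -> H) :=
  forall u v, hdot (x u) v = hdot u (y v).

Definition commutant (R : realType) (H : hilbertType R) (A : set (H -> H)) :
    set (H -> H) :=
  [set y | bounded_op y /\ forall x, A x -> x \o y = y \o x].

(* Von Neumann algebras act on a Hilbert space H and contain its identity;
   the subalgebra generated by A is then [smallest von_neumann A]. *)
Definition von_neumann (R : realType) (H : hilbertType R) : set (set (H -> H)) :=
  [set A | [/\ A `<=` @bounded_op R H H,
               forall x, A x -> exists2 y, A y & adjoint x y &
               commutant (commutant A) = A]].

(* Normality is sigma-weak continuity: tau is the restriction to M of a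
   functional x |-> \sum_n <x (xi n), eta n> with square-summable xi, eta.
   Only the values of tau on M matter. *)
Record tracial_state (R : realType) (H : hilbertType R) (M : set (H -> H))
    (tau : (H -> H) -> R[i]) : Prop := {
  trace_linear : forall a x y, M x -> M y ->
    tau (a *: x + y) = a * tau x + tau y ;
  trace_unital : tau idfun = 1 ;
  trace_positive : forall x x', M x -> adjoint x x' -> 0 <= tau (x' \o x) ;
  trace_faithful : forall x x', M x -> adjoint x x' ->
    tau (x' \o x) = 0 -> x = 0 ;
  trace_cyclic : forall x y, M x -> M y -> tau (x \o y) = tau (y \o x) ;
  trace_normal : exists xi eta : nat -> H,
    [/\ square_summable xi, square_summable eta &
        forall x, M x ->
          series (fun n => hdot (x (xi n)) (eta n) : R[i]^o) @ \oo
            --> (tau x : R[i]^o)] }.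

(* L^2(M, tau) as an M-M-bimodule.  It is given by the properties that
   determine it up to a unique unitary compatible with vec: vec x is the vector
   of x in M, and lmul x, rmul x are the bounded extensions of left and right
   multiplication by x in M. *)
Record gns (R : realType) (H : hilbertType R) (M : set (H -> H))
    (tau : (H -> H) -> R[i]) := Gns {
  gns_space :> hilbertType R ;
  vec : (H -> H) -> gns_space ;
  lmul : (H -> H) -> gns_space -> gns_space ;
  rmul : (H -> H) -> gns_space -> gns_space ;
  vec_linear : forall a x y, M x -> M y ->
    vec (a *: x + y) = a *: vec x + vec y ;
  vec_dot : forall x y y', M x -> M y -> adjoint y y' ->
    hdot (vec x) (vec y) = tau (y' \o x) ;
  vec_dense : closure (vec @` M) = setT ;
  lmul_bounded : forall x, M x -> bounded_op (lmul x) ;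
  lmul_vec : forall x y, M x -> M y -> lmul x (vec y) = vec (x \o y) ;
  rmul_bounded : forall x, M x -> bounded_op (rmul x) ;
  rmul_vec : forall x y, M x -> M y -> rmul x (vec y) = vec (y \o x) }.
Arguments vec {R H M tau} g x.
Arguments lmul {R H M tau} g x xi.
Arguments rmul {R H M tau} g x xi.

Definition tensor_sums (H K : Type) (D : nmodType) (f : H -> K -> D)
    (V : set H) (W : set K) : set D :=
  [set t | exists n (a : 'I_n -> H) (b : 'I_n -> K),
     (forall i, V (a i) /\ W (b i)) /\ t = \sum_(i < n) f (a i) (b i)].

(* The Hilbert space tensor product of H and K, also given up to a unique
   unitary; tens a b is the elementary tensor of a and b, and top A B is the
   tensor product of the bounded operators A and B. *)
Record hilbert_tensor (R : realType) (H K : hilbertType R) := HilbertTensor {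
  tensor_space :> hilbertType R ;
  tens : H -> K -> tensor_space ;
  top : (H -> H) -> (K -> K) -> tensor_space -> tensor_space ;
  tens_linearl : forall b, linear (tens^~ b) ;
  tens_linearr : forall a, linear (tens a) ;
  tens_dot : forall a b c d,
    hdot (tens a b) (tens c d) = hdot a c * hdot b d ;
  tens_dense : closure (tensor_sums tens setT setT) = setT ;
  top_bounded : forall A B, bounded_op A -> bounded_op B ->
    bounded_op (top A B) ;
  top_tens : forall A B a b, bounded_op A -> bounded_op B ->
    top A B (tens a b) = tens (A a) (B b) }.
Arguments tens {R H K} h a b.
Arguments top {R H K} h A B t.

(* The Hilbert direct sum of countably many copies of T: through coord, it is
   the space of square-summable sequences in T. *)
Record hilbert_sum (R : realType) (T : hilbertType R) := HilbertSum {
  sum_space :> hilbertType R ;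
  coord : sum_space -> nat -> T ;
  coord_linear : forall a s t, coord (a *: s + t) = a *: coord s + coord t ;
  coord_range : range coord = @square_summable R T ;
  coord_dot : forall s t,
    series (fun n => hdot (coord s n) (coord t n) : R[i]^o) @ \oo
      --> (hdot s t : R[i]^o) }.

(* x . t . y in L^2(M) (x) L^2(M) *)
Definition bimul (R : realType) (H : hilbertType R) (M : set (H -> H))
    (tau : (H -> H) -> R[i]) (L : gns M tau) (LL : hilbert_tensor L L)
    (x y : H -> H) (t : LL) : LL :=
  top LL (lmul L x) (rmul L y) t.

Record unital_star_subalgebra (R : realType) (H : hilbertType R)
    (M D : set (H -> H)) : Prop := {
  subalg_sub : D `<=` M ;
  subalg_one : D idfun ;
  subalg_linear : forall (a : R[i]) x y, D x -> D y -> D (a *: x + y) ;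
  subalg_mul : forall x y, D x -> D y -> D (x \o y) ;
  subalg_star : forall x, D x -> exists2 y, D y & adjoint x y }.

(* Only the values of delta on dom matter. *)
Record derivation (R : realType) (H : hilbertType R) (M : set (H -> H))
    (tau : (H -> H) -> R[i]) (L : gns M tau) (LL : hilbert_tensor L L)
    (S : hilbert_sum LL) (dom : set (H -> H)) (delta : (H -> H) -> S) :
    Prop := {
  deriv_linear : forall a x y, dom x -> dom y ->
    delta (a *: x + y) = a *: delta x + delta y ;
  deriv_leibniz : forall x y, dom x -> dom y -> forall n,
    coord (delta (x \o y)) n =
      bimul idfun y (coord (delta x) n) + bimul x idfun (coord (delta y) n) }.

Section Kernels.
Variables (R : realType) (H : hilbertType R) (S : hilbertType R).
Variables (dom : set (H -> H)) (delta : (H -> H) -> S).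

Definition deriv_ker : set (H -> H) := [set x | dom x /\ delta x = 0].

Definition deriv_ker_star : set (H -> H) :=
  [set y | exists2 x, deriv_ker x & adjoint x y].

Variables (M : set (H -> H)) (tau : (H -> H) -> R[i]) (L : gns M tau).

(* The closure in L^2(M) x S of the graph of delta, viewed as an unbounded
   operator on L^2. *)
Definition closed_graph : set (L * S) :=
  closure [set p | exists2 x, dom x & p = (vec L x, delta x)].

Definition closable := forall s : S, closed_graph (0, s) -> s = 0.

Definition closure_ker : set L := [set xi | closed_graph (xi, 0)].

End Kernels.
Arguments closed_graph {R H S} dom delta {M tau} L _.
Arguments closable {R H S} dom delta {M tau} L.
Arguments closure_ker {R H S} dom delta {M tau} L _.

Section Anticoarse.
Variables (R : realType) (H : hilbertType R) (M : set (H -> H)).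
Variables (tau : (H -> H) -> R[i]) (L : gns M tau) (LL : hilbert_tensor L L).

(* L^2(A, tau) as a subspace of L^2(M, tau) *)
Definition L2 (A : set (H -> H)) : set L := closure (vec L @` A).

(* L^2(A, tau) (x) L^2(A, tau) as a subspace of L^2(M, tau) (x) L^2(M, tau) *)
Definition L2tens (A : set (H -> H)) : set LL :=
  closure (tensor_sums (tens LL) (L2 A) (L2 A)).

(* The bounded Q-Q-bimodular maps from L^2(N) to L^2(Q) (x) L^2(Q); the values
   of F outside L^2(N) are irrelevant. *)
Record bimodular_map (Q N : set (H -> H)) (F : L -> LL) : Prop := {
  bim_linear : forall a xi eta, L2 N xi -> L2 N eta ->
    F (a *: xi + eta) = a *: F xi + F eta ;
  bim_bounded : exists C : R[i], forall xi, L2 N xi -> `|F xi| <= C * `|xi| ;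
  bim_range : forall xi, L2 N xi -> L2tens Q (F xi) ;
  bim_bimodular : forall x y xi, Q x -> Q y -> L2 N xi ->
    F (lmul L x (rmul L y xi)) = bimul x y (F xi) }.

Definition anticoarse (Q N : set (H -> H)) : set L :=
  [set xi | L2 N xi /\ forall F, bimodular_map Q N F -> F xi = 0].

End Anticoarse.

(* Main.v *)
Require Import Defs.
From HB Require Import structures.
From mathcomp Require Import all_boot all_order all_algebra.
From mathcomp Require Import sesquilinear complex.
From mathcomp Require Import all_classical all_reals all_analysis.
From mathcomp Require Import ring lra.

Set Implicit Arguments.
Unset Strict Implicit.
Unset Printing Implicit Defensive.

Import Order.TTheory GRing.Theory Num.Theory.
Import numFieldNormedType.Exports.

Local Open Scope classical_set_scope.
Local Open Scope ring_scope.
Local Open Scope complex_scope.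

(* Let G be the closure of the graph of delta and, for xi in L^2(M), let B xi be
   the second component of the orthogonal projection of (xi, 0) onto G.  Let A be
   the star-algebra ker(delta) :&: ker(delta)^*.  It acts on G from both sides, so
   B is A-A-bimodular.  Since tau is normal, the double commutant theorem on l2(H)
   shows that a star-algebra is L^2-dense in the von Neumann algebra it generates,
   so B is even Q-Q-bimodular.  Let E be the projection of L^2(M) onto L^2(Q).
   Composing a coordinate of B with the maps a (x) b |-> E(a m) (x) E(m' b), which
   are Q-Q-bimodular and separate the points of L^2(M) (x) L^2(M), gives bimodular
   maps into L^2(Q) (x) L^2(Q).  They kill an anticoarse xi, so that B xi = 0: the
   projection of (xi, 0) is some (eta, 0) in G, and xi - eta is orthogonal to dom.
   Both vectors lie in L^2(N), so xi = eta. *)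

(** * Hilbert spaces as real inner product spaces *)

(** The closure of [delta] is unbounded and only densely defined, so it is not among the maps that
    an anticoarse vector annihilates; the graph projection trades it for an everywhere defined
    bounded map. Bimodularity survives only for operators that preserve the graph together with
    their adjoints, which is why the kernel is intersected with its adjoint. Two obstacles remain.
    An L^2-approximation of x in Q by a in A says nothing about the norm of multiplication by x - a;
    so bimodularity is tested on vectors and tensors coming from M, where both sides are continuous
    in the vectors of x and x^*, and traciality makes one a serve for both. Moreover [delta] takes
    values over M while the test maps take values over Q, which the compressions repair. Projections
    occur in Hilbert spaces, in l2(H) and in the space of pairs containing the graph, so they are
    built once for an abstract form; a real form suffices because the subspaces are complex. *)

Section RealInnerProduct.
Variables (R : realType) (H : hilbertType R).
Implicit Types (u v w : H) (a : R[i]) (t : R).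

Lemma hdotPl a u v w : hdot (a *: u + v) w = a * hdot u w + hdot v w.
Proof. exact: linearPl. Qed.

Lemma hdotBl u v w : hdot (u - v) w = hdot u w - hdot v w.
Proof. exact: linearBl. Qed.

Lemma hdotZl a u v : hdot (a *: u) v = a * hdot u v.
Proof. exact: linearZl_LR. Qed.

Lemma hdotZr a u v : hdot u (a *: v) = Num.conj a * hdot u v.
Proof. exact: linearZr_LR. Qed.

Lemma hdotDr u v w : hdot w (u + v) = hdot w u + hdot w v.
Proof. exact: linearDr. Qed.

Lemma hdot0l u : hdot 0 u = 0.
Proof. exact: linear0l. Qed.

Lemma hdot0r u : hdot u 0 = 0.
Proof. exact: linear0r. Qed.

(** The real part gives the same norm and takes values in an ordered field, where [lra] and [nra]
    apply. Nothing is lost: [hdotE] recovers the whole product, and [rdotZ] keeps track of complex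
    scalars. *)
Definition rdot u v : R := complex.Re (hdot u v).

Lemma ReD a b : complex.Re (a + b) = complex.Re a + complex.Re b.
Proof. by case: a b => [? ?] [? ?]. Qed.

Lemma ReN a : complex.Re (- a) = - complex.Re a.
Proof. by case: a. Qed.

Lemma Re_conj a : complex.Re (Num.conj a) = complex.Re a.
Proof. by case: a. Qed.

Lemma rdotC u v : rdot u v = rdot v u.
Proof. by rewrite /rdot hermC expr0 mul1r Re_conj. Qed.

Lemma rdotDl u v w : rdot (u + v) w = rdot u w + rdot v w.
Proof. by rewrite /rdot linearDl ReD. Qed.

Lemma rdotNl u v : rdot (- u) v = - rdot u v.
Proof. by rewrite /rdot linearNl ReN. Qed.

Lemma rdotDr u v w : rdot w (u + v) = rdot w u + rdot w v.
Proof. by rewrite rdotC rdotDl ![rdot _ w]rdotC. Qed.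

Lemma rdotNr u v : rdot u (- v) = - rdot u v.
Proof. by rewrite rdotC rdotNl rdotC. Qed.

Lemma rdotBl u v w : rdot (u - v) w = rdot u w - rdot v w.
Proof. by rewrite rdotDl rdotNl. Qed.

Lemma rdotBr u v w : rdot w (u - v) = rdot w u - rdot w v.
Proof. by rewrite rdotDr rdotNr. Qed.

Lemma rdot0l u : rdot 0 u = 0.
Proof. by rewrite -[0]subr0 rdotBl subrr. Qed.

Lemma rdot0r u : rdot u 0 = 0.
Proof. by rewrite rdotC rdot0l. Qed.

Lemma rdotZ a u v : rdot (a *: u) v = rdot u (conjc a *: v).
Proof.
rewrite /rdot linearZl_LR linearZr_LR /=.
by case: a => x y; case: (hdot u v) => z t /=; rewrite opprK.
Qed.

Lemma rdotZl t u v : rdot (t%:C *: u) v = t * rdot u v.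
Proof.
by rewrite /rdot linearZl_LR /=; case: (hdot u v) => x y;
  rewrite /= mul0r subr0.
Qed.

Lemma hdotE u v : hdot u v = (rdot u v) +i* (rdot u ('i *: v)).
Proof.
rewrite /rdot linearZr_LR /=; case: (hdot u v) => x y /=.
by rewrite mul0r sub0r mulN1r opprK.
Qed.

Lemma normr_rdot u : `|u| ^+ 2 = (rdot u u)%:C.
Proof.
have /ger0_Im := dnorm_ge0 (@hdot R H) u.
by rewrite hdot_norm /rdot; case: (hdot u u) => x y /= ->.
Qed.

Lemma rdot_ge0 u : 0 <= rdot u u.
Proof. by rewrite -lecR -normr_rdot exprn_ge0. Qed.

Lemma rdot_eq0 u : rdot u u = 0 -> u = 0.
Proof.
by move=> u0; apply/normr0_eq0/eqP; rewrite -sqrf_eq0 normr_rdot u0.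
Qed.

Lemma normr_lt t u : 0 <= t -> (`|u| < t%:C) = (rdot u u < t ^+ 2).
Proof.
move=> t0; rewrite -(@ltr_pXn2r _ 2) ?nnegrE ?lecR //.
by rewrite normr_rdot -rmorphXn /= ltcR.
Qed.

End RealInnerProduct.

Lemma gt0_complex (R : realType) (e : R[i]) : 0 < e ->
  exists2 t : R, 0 < t & e = t%:C.
Proof.
case: e => x y; rewrite ltcE /= => /andP[/eqP -> x0].
by exists x.
Qed.

Lemma ge0_complex (R : realType) (e : R[i]) : 0 <= e ->
  exists2 t : R, 0 <= t & e = t%:C.
Proof.
case: e => x y; rewrite lecE /= => /andP[/eqP -> x0].
by exists x.
Qed.

(** * Closures, bounded operators and limits in terms of squared distances *)

Section Topology.
Variables (R : realType).
Implicit Types (H K : hilbertType R).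

Lemma closureP H (A : set H) u :
  closure A u <->
  forall e : R, 0 < e -> exists2 a, A a & rdot (u - a) (u - a) < e.
Proof.
split=> [Au e e0|h B /nbhs_ballP[_ /gt0_complex[e e0 ->]]].
  have /Au[a [Aa]] : nbhs u (ball u (Num.sqrt e)%:C).
    by apply: nbhsx_ballx; rewrite ltcR sqrtr_gt0.
  rewrite -ball_normE /= normr_lt ?sqrtr_ge0 // sqr_sqrtr ?ltW // => ae.
  by exists a.
have e20 : 0 < e ^+ 2 by rewrite exprn_gt0.
have [a Aa ae] := h _ e20; move=> eB; exists a; split=> //; apply: eB.
by rewrite -ball_normE /= normr_lt // ltW.
Qed.

Lemma bounded_op_norm H K (f : H -> K) : bounded_op f ->
  exists2 t : R, 0 <= t & forall u, `|f u| <= t%:C * `|u|.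
Proof.
move=> [lf cf].
pose F : {linear H -> K} := HB.pack f (GRing.isLinear.Build _ _ _ _ f lf).
have /linear_bounded_continuous/linear_boundedP[r [rr]] : continuous F by [].
have r0 : `|r| + 1 > r.
  by apply: (@le_lt_trans _ _ `|r|); rewrite ?real_ler_norm ?ltrDl.
move=> /(_ (`|r| + 1) r0) /= fC.
have /ge0_complex[t t0 tE] : 0 <= `|r| + 1 by rewrite addr_ge0.
by exists t => // u; rewrite -tE.
Qed.

Lemma bounded_opP H K (f : H -> K) : bounded_op f <->
  linear f /\ exists2 C, 0 <= C & forall u, rdot (f u) (f u) <= C * rdot u u.
Proof.
split=> [bf|[lf [C C0 fC]]]; split=> //; first by case: bf.
  have [t t0 ft] := bounded_op_norm bf.
  exists (t ^+ 2); first exact: exprn_ge0.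
  move=> u; rewrite -lecR -normr_rdot.
  have -> : (t ^+ 2 * rdot u u)%:C = (t%:C * `|u|) ^+ 2.
    by rewrite exprMn normr_rdot -rmorphXn -rmorphM.
  by rewrite ler_pXn2r ?nnegrE ?mulr_ge0 ?lecR.
pose F : {linear H -> K} := HB.pack f (GRing.isLinear.Build _ _ _ _ f lf).
suff : continuous F by [].
apply/linear_bounded_continuous/linear_boundedP; exists (Num.sqrt C)%:C.
split; first by rewrite ger0_real // lecR sqrtr_ge0.
move=> r rC u; apply: (@le_trans _ _ ((Num.sqrt C)%:C * `|u|)); last first.
  by rewrite ler_wpM2r // ltW.
rewrite -(@ler_pXn2r _ 2) ?nnegrE //;
  last by rewrite mulr_ge0 // lecR sqrtr_ge0.
by rewrite exprMn !normr_rdot -rmorphXn -rmorphM lecR sqr_sqrtr.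
Qed.

(** The form is a parameter because the same notions serve [rdot], [l2dot] and [pdot]. *)
Definition rcauchy (V : zmodType) (dot : V -> V -> R) (u : nat -> V) :=
  forall e : R, 0 < e -> exists N, forall m n, (N <= m)%N -> (N <= n)%N ->
    dot (u m - u n) (u m - u n) < e.

Definition rcvg (V : zmodType) (dot : V -> V -> R) (u : nat -> V) l :=
  forall e : R, 0 < e -> exists N, forall n, (N <= n)%N ->
    dot (l - u n) (l - u n) < e.

Lemma rcauchy_cvg H (u : nat -> H) : rcauchy (@rdot R H) u ->
  exists l, rcvg (@rdot R H) u l.
Proof.
move=> cu.
have /cauchy_cvgP/cvg_ex[l ul] : cauchy (u @ \oo).
  apply/cauchy_ballP => _/gt0_complex[e e0 ->].
  have /cu[N uN] : 0 < e ^+ 2 by rewrite exprn_gt0.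
  pose T := u @` [set n | (N <= n)%N].
  exists (T, T) => /=; first by split; exists N => // n Nn; exists n.
  move=> [_ _] /= [[m Nm <-] [n Nn <-]].
  by rewrite -ball_normE /= normr_lt ?uN // ltW.
exists l => e e0.
have /cvgrPdist_lt/(_ (Num.sqrt e)%:C) := ul.
rewrite ltcR sqrtr_gt0 => /(_ e0)[N _ Ne]; exists N => n Nn.
by have := Ne n Nn; rewrite /= normr_lt ?sqrtr_ge0 // sqr_sqrtr // ltW.
Qed.

Lemma closure_prodP H K (A : set (H * K)) (p : H * K) : closure A p <->
  forall e : R, 0 < e -> exists2 a, A a &
    rdot (p.1 - a.1) (p.1 - a.1) + rdot (p.2 - a.2) (p.2 - a.2) < e.
Proof.
split=> [Ap e e0|h B].
  pose r := Num.sqrt (e / 2); have e2 : 0 < e / 2 by rewrite divr_gt0.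
  have [] := Ap (ball p.1 r%:C `*` ball p.2 r%:C).
    by exists (ball p.1 r%:C, ball p.2 r%:C) => //=; split;
       apply: nbhsx_ballx; rewrite ltcR sqrtr_gt0.
  move=> a [Aa [/=]]; rewrite -!ball_normE /= !normr_lt ?sqrtr_ge0 //.
  by rewrite sqr_sqrtr ?ltW // => ? ?; exists a => //; lra.
case=> -[B1 B2] /= [/nbhs_ballP[_ /gt0_complex[e e0 ->] B1e]].
move=> /nbhs_ballP[_ /gt0_complex[d d0 ->] B2d] sB.
pose m := Num.min (e ^+ 2) (d ^+ 2).
have m0 : 0 < m by rewrite lt_min !exprn_gt0.
have [a Aa] := h m m0; rewrite /m lt_min => /andP[ae ad].
have := rdot_ge0 (p.1 - a.1); have := rdot_ge0 (p.2 - a.2) => ? ?.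
exists a; split=> //; apply: sB; split => /=.
  by apply: B1e; rewrite -ball_normE /= normr_lt ?ltW //; lra.
by apply: B2d; rewrite -ball_normE /= normr_lt ?ltW //; lra.
Qed.

End Topology.

(** * Orthogonal projections *)

Section Projection.
Variables (R : realType) (V : lmodType R[i]).
Implicit Types (W D : set V) (dot : V -> V -> R).

Definition is_subspace W := W 0 /\ forall a x y, W x -> W y -> W (a *: x + y).

Lemma is_subspaceD W x y : is_subspace W -> W x -> W y -> W (x + y).
Proof. by move=> [_ sW] Wx Wy; rewrite -[x]scale1r; apply: sW. Qed.

Lemma is_subspaceZ W a x : is_subspace W -> W x -> W (a *: x).
Proof. by move=> [W0 sW] Wx; rewrite -[_ *: x]addr0; apply: sW. Qed.

Lemma is_subspaceB W x y : is_subspace W -> W x -> W y -> W (x - y).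
Proof. by move=> [_ sW] Wx Wy; rewrite addrC -scaleN1r; apply: sW. Qed.

(** The domain [D] accommodates [l2dot], a limit that is meaningful only on [l2]. [innerZ] moves
    complex scalars across the real form; through it, projections onto complex subspaces are complex
    linear. *)
Record inner_product D dot : Prop := {
  inner_subspace : is_subspace D ;
  innerC : forall x y, D x -> D y -> dot x y = dot y x ;
  innerP : forall (t : R) x y z, D x -> D y -> D z ->
    dot (t%:C *: x + y) z = t * dot x z + dot y z ;
  innerZ : forall a x y, D x -> D y -> dot (a *: x) y = dot x (conjc a *: y) ;
  inner_ge0 : forall x, D x -> 0 <= dot x x ;
  inner_eq0 : forall x, D x -> dot x x = 0 -> x = 0 }.

Definition complete_in dot W := forall s : nat -> V,
  (forall n, W (s n)) -> rcauchy dot s -> exists2 l, W l & rcvg dot s l.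

Definition is_projection D dot W (p : V -> V) :=
  forall u, D u -> W (p u) /\ forall z, W z -> dot (u - p u) z = 0.

Section Form.
Variables (D : set V) (dot : V -> V -> R) (dotP : inner_product D dot).

Let sD := inner_subspace dotP.

Lemma innerDl x y z : D x -> D y -> D z -> dot (x + y) z = dot x z + dot y z.
Proof.
by move=> Dx Dy Dz; have := innerP dotP 1 Dx Dy Dz; rewrite scale1r mul1r.
Qed.

Lemma inner0l z : D z -> dot 0 z = 0.
Proof.
move=> Dz; have D0 := sD.1; have := innerDl D0 D0 Dz.
by rewrite addr0 => /eqP;
  rewrite -subr_eq0 opprD addrA subrr sub0r oppr_eq0 => /eqP.
Qed.

Lemma innerZl (t : R) x z : D x -> D z -> dot (t%:C *: x) z = t * dot x z.
Proof.
move=> Dx Dz; have := innerP dotP t Dx sD.1 Dz.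
by rewrite !addr0 inner0l // addr0.
Qed.

Lemma innerBl x y z : D x -> D y -> D z -> dot (x - y) z = dot x z - dot y z.
Proof.
move=> Dx Dy Dz; have := innerP dotP (-1) Dy Dx Dz.
by rewrite rmorphN1 scaleN1r mulN1r addrC [RHS]addrC.
Qed.

Lemma inner_lin2 (s t : R) x y : D x -> D y ->
  dot (s%:C *: x + t%:C *: y) (s%:C *: x + t%:C *: y) =
  s ^+ 2 * dot x x + 2 * s * t * dot x y + t ^+ 2 * dot y y.
Proof.
move=> Dx Dy.
have Dsx : D (s%:C *: x) by exact: is_subspaceZ.
have Dty : D (t%:C *: y) by exact: is_subspaceZ.
have Dz := is_subspaceD sD Dsx Dty.
rewrite (innerDl Dsx Dty Dz) !innerZl // !(innerC dotP _ Dz) //.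
rewrite !(innerDl Dsx Dty) //.
by rewrite !innerZl // (innerC dotP Dy Dx); ring.
Qed.

Lemma innerD_le x y : D x -> D y ->
  dot (x + y) (x + y) <= 2 * dot x x + 2 * dot y y.
Proof.
move=> Dx Dy; have := inner_ge0 dotP (is_subspaceB sD Dx Dy).
have := inner_lin2 1 1 Dx Dy; have := inner_lin2 1 (-1) Dx Dy.
rewrite rmorphN1 scaleN1r !scale1r => -> ->; lra.
Qed.

Lemma innerB_le x y z : D x -> D y -> D z ->
  dot (x - z) (x - z) <= 2 * dot (x - y) (x - y) + 2 * dot (y - z) (y - z).
Proof.
move=> Dx Dy Dz.
have := innerD_le (is_subspaceB sD Dx Dy) (is_subspaceB sD Dy Dz).
by rewrite addrA subrK.
Qed.

Lemma innerZZ a x : D x ->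
  dot (a *: x) (a *: x) = (complex.Re a ^+ 2 + complex.Im a ^+ 2) * dot x x.
Proof.
move=> Dx; have Dax : D (a *: x) by exact: is_subspaceZ.
rewrite (innerZ dotP) // (innerC dotP) ?scalerA; [|by []|exact: is_subspaceZ].
by rewrite mulrC -innerZl // add_Re2_Im2 normCK.
Qed.

Lemma inner_CauchySchwarz x y : D x -> D y -> dot x y ^+ 2 <= dot x x * dot y y.
Proof.
move=> Dx Dy; have D0 := sD.1; have [x0|x0] := eqVneq (dot x x) 0.
  by rewrite (inner_eq0 dotP Dx x0) !inner0l // mul0r expr0n.
have xp : 0 < dot x x by rewrite lt_neqAle eq_sym x0 (inner_ge0 dotP).
(* The squared norm of <x, x> y - <x, y> x is <x, x> times the defect of the inequality. *)
have := inner_ge0 dotP (is_subspaceD sD (is_subspaceZ (- dot x y)%:C sD Dx)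
                                     (is_subspaceZ (dot x x)%:C sD Dy)).
rewrite inner_lin2 //.
set a := dot x x; set b := dot x y; set c := dot y y.
have -> : (- b) ^+ 2 * a + 2 * - b * a * b + a ^+ 2 * c = a * (a * c - b ^+ 2).
  by ring.
by rewrite pmulr_rge0 // subr_ge0.
Qed.

Section Minimizer.
Variables (W : set V) (sW : is_subspace W) (WD : W `<=` D).
Variables (u : V) (Du : D u).

Let sqdist w := dot (u - w) (u - w).
Let d := inf (sqdist @` W).

Let sqdist_ge w : W w -> d <= sqdist w.
Proof.
move=> Ww; apply: ge_inf; last by exists w.
exists 0 => _ [z Wz <-]; apply: (inner_ge0 dotP).
by apply: is_subspaceB => //; apply: WD.
Qed.

(** Moving [w] along [z] by the optimal step <u - w, z> / <z, z> lowers the squared distance by <u -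
    w, z>^2 / <z, z>, and this gain cannot exceed [e]. *)
Let near_minimizer w e z : 0 <= e -> W w -> W z -> sqdist w <= d + e ->
  dot (u - w) z ^+ 2 <= e * dot z z.
Proof.
move=> e0 Ww Wz we; have Dz := WD Wz.
have D0 := sD.1; have [z0|z0] := eqVneq (dot z z) 0.
  have Duw := is_subspaceB sD Du (WD Ww).
  by rewrite (inner_eq0 dotP Dz z0) (innerC dotP Duw D0) !inner0l // mulr0
    expr0n.
have zp : 0 < dot z z by rewrite lt_neqAle eq_sym z0 (inner_ge0 dotP).
pose t := dot (u - w) z / dot z z.
have := sqdist_ge (is_subspaceD sW Ww (is_subspaceZ t%:C sW Wz)).
have -> : sqdist (w + t%:C *: z) = sqdist w - dot (u - w) z ^+ 2 / dot z z.
  have -> : sqdist (w + t%:C *: z) =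
      dot (1%:C *: (u - w) + (- t)%:C *: z) (1%:C *: (u - w) + (- t)%:C *: z).
    by rewrite scale1r rmorphN scaleNr /sqdist opprD addrA.
  rewrite inner_lin2 ?/sqdist //; last exact: is_subspaceB sD Du (WD Ww).
  by rewrite /t; field.
move=> h; rewrite -ler_pdivrMr //; lra.
Qed.

Lemma projection_exists : complete_in dot W ->
  exists2 w, W w & forall z, W z -> dot (u - w) z = 0.
Proof.
move=> cW.
have inf_approx n : exists w, W w /\ sqdist w <= d + n.+1%:R^-1.
  have : has_inf (sqdist @` W).
    split; first by exists (sqdist 0), 0 => //; exact: sW.1.
    exists 0 => _ [z Wz <-]; apply: (inner_ge0 dotP).
    by apply: is_subspaceB => //; apply: WD.
  move=> /inf_adherent - /(_ n.+1%:R^-1); rewrite invr_gt0 ltr0n.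
  by case=> // _ [w Ww <-] /ltW ?; exists w.
have [s sP] := choice inf_approx.
have Dus n : D (u - s n) by apply: is_subspaceB => //; apply: WD; case: (sP n).
have close n m z : (n <= m)%N -> W z ->
    dot (u - s m) z ^+ 2 <= n.+1%:R^-1 * dot z z.
  move=> nm Wz; have [Ws sd] := sP m; apply: near_minimizer => //.
  by rewrite (le_trans sd) // lerD2l lef_pV2 ?posrE ?ltr0n // ler_nat.
have small e : 0 < e -> exists N, N.+1%:R^-1 < e :> R.
  move=> e0; have [N] := ltr_add_invr (y := 0) (x := e) e0.
  by rewrite add0r; exists N.
have [] := cW s (fun n => (sP n).1).
  move=> e e0; have [|N Ne] := small (e / 4); first lra.
  exists N => m n Nm Nn.
  (* <z, z> is <u - s n, z> - <u - s m, z>, and both terms have square at most <z, z> / (N + 1). So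
     <z, z>^2 <= 4 <z, z> / (N + 1), whence the choice of e / 4. *)
  set z := s m - s n; have Wz : W z by apply: is_subspaceB (sP m).1 (sP n).1.
  have Dz := WD Wz; have := close _ _ _ Nm Wz; have := close _ _ _ Nn Wz.
  have zz : dot z z = dot (u - s n) z - dot (u - s m) z.
    rewrite -innerBl //; congr (dot _ _).
    by rewrite opprB addrC addrA subrK.
  move=> b2 a2; rewrite ltNge; apply/negP => ez; move: zz ez b2 a2.
  move: (dot z z) (dot (u - s n) z) (dot (u - s m) z) => q a b qE eq.
  have : N.+1%:R^-1 * q < e / 4 * q by rewrite ltr_pM2r // (lt_le_trans e0).
  have : e * q <= q * q by rewrite ler_pM2r // (lt_le_trans e0).
  have : q * q + (a + b) ^+ 2 = 2 * (a ^+ 2 + b ^+ 2) by rewrite qE; ring.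
  have := sqr_ge0 (a + b); move: (N.+1%:R^-1) => r; lra.
move=> l Wl sl; exists l => // z Wz; have Dz := WD Wz; have Dl := WD Wl.
apply/eqP; rewrite -sqrf_eq0 eq_le sqr_ge0 andbT; apply/ler_addgt0Pl => e e0.
rewrite addr0.
have zp : 0 < dot z z + 1 by rewrite ltr_pwDr // (inner_ge0 dotP).
have e'0 : 0 < e / 4 / (dot z z + 1) by rewrite !divr_gt0.
have [N1 N1e] := small _ e'0; have [N2 N2e] := sl _ e'0.
pose n := maxn N1 N2; have Ds : D (s n) by apply: WD; case: (sP n).
have -> : dot (u - l) z = dot (u - s n) z - dot (l - s n) z.
  by rewrite -innerBl //; [congr dot;
    rewrite opprB addrA subrK|exact: is_subspaceB].
have := close N1 n z (leq_maxl _ _) Wz.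
have := inner_CauchySchwarz (is_subspaceB sD Dl Ds) Dz.
have {N2e} := N2e n (leq_maxr _ _).
move: (dot (u - s n) z) (dot (l - s n) z) (dot (l - s n) (l - s n)) => a b c.
set e' := e / 4 / _ in e'0 N1e *; have e'E : e' * (dot z z + 1) = e / 4.
  by rewrite /e' divfK // gt_eqF.
move: e'E e'0 N1e (inner_ge0 dotP Dz);
  move: (dot z z) (N1.+1%:R^-1) e' => q r e'.
move=> e'E e'0 re' q0 ce' b2 a2.
have : r * q <= e' * q by rewrite ler_wpM2r // ltW.
have : c * q <= e' * q by rewrite ler_wpM2r // ltW.
have : (a - b) ^+ 2 + (a + b) ^+ 2 = 2 * (a ^+ 2 + b ^+ 2) by ring.
have := sqr_ge0 (a + b); lra.
Qed.

End Minimizer.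

Lemma projection_op W : is_subspace W -> W `<=` D -> complete_in dot W ->
  exists p : V -> V, is_projection D dot W p.
Proof.
move=> sW WD cW.
have h u : exists w, D u -> W w /\ forall z, W z -> dot (u - w) z = 0.
  have [Du|nDu] := pselect (D u); last by exists 0.
  by have [w Ww wu] := projection_exists sW WD Du cW; exists w.
by have [p pP] := choice h; exists p.
Qed.

Section ProjectionTheory.
Variables (W : set V) (p : V -> V).
Hypotheses (sW : is_subspace W) (WD : W `<=` D) (pP : is_projection D dot W p).

Lemma proj_in u : D u -> W (p u). Proof. by case/pP. Qed.

Lemma proj_orth u z : D u -> W z -> dot (u - p u) z = 0.
Proof. by case/pP => _; apply. Qed.

Lemma proj_uniq u w : D u -> W w -> (forall z, W z -> dot (u - w) z = 0) ->
  p u = w.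
Proof.
move=> Du Ww uw; have Wpu := proj_in Du; apply/eqP; rewrite -subr_eq0;
  apply/eqP.
have Wz : W (p u - w) by exact: is_subspaceB.
have Dpu := WD Wpu; have Dw := WD Ww; have Dz := WD Wz.
apply: (inner_eq0 dotP) => //.
have := uw _ Wz; have := proj_orth Du Wz.
by rewrite !(innerBl Du) // innerBl // => /subr0_eq <- /subr0_eq <-;
  rewrite subrr.
Qed.

Lemma proj_id w : W w -> p w = w.
Proof.
move=> Ww; apply: proj_uniq => [||z Wz] //; first exact: WD.
by rewrite subrr inner0l //; apply: WD.
Qed.

Lemma proj_linear a x y : D x -> D y -> p (a *: x + y) = a *: p x + p y.
Proof.
move=> Dx Dy; have Wx := proj_in Dx; have Wy := proj_in Dy.
have Dxp := is_subspaceB sD Dx (WD Wx); have Dyp := is_subspaceB sD Dy (WD Wy).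
apply: proj_uniq => [||z Wz]; first exact: sD.2.
  exact: sW.2.
rewrite opprD addrACA -scalerBr innerDl //; last 2 first.
- exact: is_subspaceZ.
- exact: WD.
rewrite (innerZ dotP) //; last exact: WD.
by rewrite !proj_orth ?addr0 //; apply: is_subspaceZ.
Qed.

Lemma proj_sym u v : D u -> D v -> dot (p u) v = dot u (p v).
Proof.
move=> Du Dv; have Wu := proj_in Du; have Wv := proj_in Dv.
have Du' := WD Wu; have Dv' := WD Wv.
have := proj_orth Du Wv; have := proj_orth Dv Wu.
rewrite !innerBl // => /subr0_eq e1 /subr0_eq e2.
by rewrite (innerC dotP) // e1 e2 (innerC dotP).
Qed.

Lemma proj_le u : D u -> dot (p u) (p u) <= dot u u.
Proof.
move=> Du; have Wu := proj_in Du; have Du' := WD Wu.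
have Duu := is_subspaceB sD Du Du'.
have := inner_ge0 dotP Duu; rewrite innerBl // (innerC dotP Du') //.
rewrite proj_orth // subr0 (innerC dotP Du) // innerBl // proj_sym //.
by rewrite (innerC dotP Du) // -proj_sym // (proj_id Wu) subr_ge0.
Qed.

(* A subspace stable under U and its adjoint reduces U. *)
Lemma proj_comm (U U' : V -> V) u :
  (forall x y, D x -> D y -> U (x - y) = U x - U y) ->
  (forall x, D x -> D (U x)) ->
  (forall x y, D x -> D y -> dot (U x) y = dot x (U' y)) ->
  (forall w, W w -> W (U w)) -> (forall w, W w -> W (U' w)) ->
  D u -> p (U u) = U (p u).
Proof.
move=> UB UD adj UW UW' Du; have Wu := proj_in Du; have Du' := WD Wu.
apply: proj_uniq => [||z Wz]; [exact: UD|exact: UW|].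
rewrite -UB // adj //; last exact: WD.
  by apply: proj_orth => //; apply: UW'.
exact: is_subspaceB.
Qed.

End ProjectionTheory.
End Form.
End Projection.

(** * Density arguments, closed subspaces and adjoints *)

Section Hilbert.
Variables (R : realType).
Implicit Types (H K : hilbertType R).

Lemma rdot_inner_product H : inner_product setT (@rdot R H).
Proof.
split; [by split|by move=> x y _ _; apply: rdotC|..].
- by move=> t x y z _ _ _; rewrite rdotDl rdotZl.
- by move=> a x y _ _; apply: rdotZ.
- by move=> x _; apply: rdot_ge0.
- by move=> x _; apply: rdot_eq0.
Qed.

Lemma rdot_CauchySchwarz H (u v : H) : rdot u v ^+ 2 <= rdot u u * rdot v v.
Proof. exact: (inner_CauchySchwarz (rdot_inner_product H)). Qed.

Lemma rdotD_le H (u v : H) :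
  rdot (u + v) (u + v) <= 2 * rdot u u + 2 * rdot v v.
Proof. exact: (innerD_le (rdot_inner_product H)). Qed.

Lemma rdotB_le H (u v w : H) :
  rdot (u - w) (u - w) <= 2 * rdot (u - v) (u - v) + 2 * rdot (v - w) (v - w).
Proof. exact: (innerB_le (rdot_inner_product H)). Qed.

Lemma rdotZZ H a (u : H) :
  rdot (a *: u) (a *: u) = (complex.Re a ^+ 2 + complex.Im a ^+ 2) * rdot u u.
Proof. exact: (innerZZ (rdot_inner_product H)). Qed.

Lemma rdot_small H (u : H) : (forall e : R, 0 < e -> rdot u u < e) -> u = 0.
Proof.
move=> h; apply: rdot_eq0; apply/eqP; rewrite eq_le rdot_ge0 andbT.
by apply/ler_addgt0Pl => e e0; rewrite addr0 ltW // h.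
Qed.

Lemma linear_sub H K (f : H -> K) u v : linear f -> f (u - v) = f u - f v.
Proof. by move=> lf; rewrite addrC -scaleN1r lf scaleN1r addrC. Qed.

Lemma linear_add H K (f : H -> K) u v : linear f -> f (u + v) = f u + f v.
Proof. by move=> lf; rewrite -[u in LHS]scale1r lf scale1r. Qed.

Lemma bounded_comp H1 H2 H3 (f : H2 -> H3) (g : H1 -> H2) :
  bounded_op f -> bounded_op g -> bounded_op (f \o g).
Proof.
move=> [lf cf] [lg cg]; split; first by move=> a x y /=; rewrite lg lf.
by move=> x; apply: continuous_comp; [apply: cg|apply: cf].
Qed.

Lemma bounded_id H : bounded_op (@idfun H).
Proof. by split=> // x; apply: cvg_id. Qed.

Lemma bounded_sub H K (f g : H -> K) :
  bounded_op f -> bounded_op g -> bounded_op (fun u => f u - g u).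
Proof.
move=> [lf cf] [lg cg]; split; last by move=> x; apply: cvgB;
  [apply: cf|apply: cg].
by move=> a x y; rewrite lf lg scalerBr opprD addrACA.
Qed.

Lemma closure_image H K (f : H -> K) (A : set H) (B : set K) u : bounded_op f ->
  (forall a, A a -> closure B (f a)) -> closure A u -> closure B (f u).
Proof.
move=> /bounded_opP[lf [C C0 fC]] AB /closureP Au; apply/closureP => e e0.
(* [C] may vanish, hence [C + 1]. *)
have e'0 : 0 < e / 4 / (C + 1) by rewrite !divr_gt0 // ltr_pwDr.
have [a Aa ae] := Au _ e'0.
have /closureP/(_ (e / 4))[|b Bb be] := AB a Aa; first by rewrite divr_gt0.
exists b => //; have := rdotB_le (f u) (f a) b; rewrite -(linear_sub _ _ lf).
have := fC (u - a).
have : C * rdot (u - a) (u - a) <= e / 4.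
  apply: (@le_trans _ _ ((C + 1) * rdot (u - a) (u - a))).
    by rewrite ler_wpM2r ?rdot_ge0 // lerDl.
  by rewrite -ler_pdivlMl ?ltr_pwDr // mulrC ltW.
lra.
Qed.

Lemma closure_closed H (A : set H) u : closure (closure A) u -> closure A u.
Proof. by rewrite -(iffLR (closure_id _) (@closed_closure _ A)). Qed.

Lemma eq_closure H K (f g : H -> K) (A : set H) u :
  bounded_op f -> bounded_op g ->
  (forall a, A a -> f a = g a) -> closure A u -> f u = g u.
Proof.
move=> bf bg fg Au; apply/eqP; rewrite -subr_eq0; apply/eqP/rdot_small => e e0.
have : closure [set 0] (f u - g u).
  apply: (closure_image (bounded_sub bf bg)) Au => a Aa.
  by apply: subset_closure; rewrite /= fg // subrr.
by move=> /closureP/(_ e e0)[_ ->]; rewrite subr0.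
Qed.

(** A bare function [q] replaces the squared norm so that the argument also covers pairs of vectors,
    as in [adjoint_density]. *)
Lemma functional_approx (V : zmodType) (q phi : V -> R) (A : set V) u :
  (forall x, 0 <= q x) -> (forall x y, phi (x - y) = phi x - phi y) ->
  (exists C, forall x, phi x ^+ 2 <= C * q x) -> (forall a, A a -> phi a = 0) ->
  (forall e, 0 < e -> exists2 a, A a & q (u - a) < e) -> phi u = 0.
Proof.
move=> q0 phiB [C phiC] phiA Au; apply/eqP.
rewrite -sqrf_eq0 eq_le sqr_ge0 andbT; apply/ler_addgt0Pl => e e0;
  rewrite addr0.
have C1 : 0 < `|C| + 1 by rewrite ltr_pwDr.
have [a Aa] := Au _ (divr_gt0 e0 C1); rewrite ltr_pdivlMr // => ae.
have := phiC (u - a); rewrite phiB (phiA a) // subr0 => /le_trans; apply.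
have := ler_wpM2r (q0 (u - a)) (ler_norm C); have := q0 (u - a); lra.
Qed.

Lemma functional_closure H (phi : H -> R) (A : set H) u :
  (forall x y, phi (x - y) = phi x - phi y) ->
  (exists C, forall x, phi x ^+ 2 <= C * rdot x x) ->
  (forall a, A a -> phi a = 0) -> closure A u -> phi u = 0.
Proof.
move=> phiB phiC phiA /closureP Au.
by apply: (functional_approx (q := fun x => rdot x x)) phiB phiC phiA Au => x;
  apply: rdot_ge0.
Qed.

Lemma orth_closure H (A : set H) u v :
  (forall a, A a -> rdot v a = 0) -> closure A u -> rdot v u = 0.
Proof.
apply: functional_closure => [x y|]; first exact: rdotBr.
by exists (rdot v v) => x; apply: rdot_CauchySchwarz.
Qed.

Lemma orth_dense H (A : set H) v :
  closure A = setT -> (forall a, A a -> rdot v a = 0) -> v = 0.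
Proof.
move=> dA vA; apply/rdot_eq0/(@orth_closure _ A) => //.
by rewrite dA.
Qed.

Definition radjoint H K (f : H -> K) (g : K -> H) :=
  forall u v, rdot (f u) v = rdot u (g v).

Lemma linear_zero H K (f : H -> K) : linear f -> f 0 = 0.
Proof. by move=> lf; rewrite -[0](subrr 0) linear_sub // subrr. Qed.

Lemma linear_scale H K (f : H -> K) a u : linear f -> f (a *: u) = a *: f u.
Proof. by move=> lf; rewrite -[_ *: u]addr0 lf linear_zero // addr0. Qed.

Lemma adjointP H (f g : H -> H) : linear g -> adjoint f g <-> radjoint f g.
Proof.
move=> lg; split=> fg u v; first by rewrite /rdot fg.
by rewrite !hdotE !fg linear_scale.
Qed.

Lemma radjoint_dense H K (f : H -> K) (g : K -> H) (A : set H) (B : set K) :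
  bounded_op f -> bounded_op g -> closure A = setT -> closure B = setT ->
  (forall a b, A a -> B b -> rdot (f a) b = rdot a (g b)) -> radjoint f g.
Proof.
move=> /bounded_opP[lf [C C0 fC]] /bounded_opP[lg [D D0 gD]] dA dB fg u v.
(* The identity is extended one variable at a time: first the left one, with [b] fixed in [B]. *)
have fgB b w : B b -> rdot (f w) b = rdot w (g b).
  move=> Bb; apply/eqP; rewrite -subr_eq0; apply/eqP.
  apply: (@functional_closure _ (fun w => rdot (f w) b - rdot w (g b)) A).
  - by move=> x y; rewrite linear_sub // !rdotBl; ring.
  - exists (2 * (C * rdot b b + rdot (g b) (g b))) => x.
    have := rdot_CauchySchwarz x (g b); have := rdot_CauchySchwarz (f x) b.
    have := ler_wpM2r (rdot_ge0 b) (fC x).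
    have := sqr_ge0 (rdot (f x) b + rdot x (g b)).
    nra.
  - by move=> a Aa; rewrite fg // subrr.
  - by rewrite dA.
apply/eqP; rewrite -subr_eq0; apply/eqP.
apply: (@functional_closure _ (fun v => rdot (f u) v - rdot u (g v)) B).
- by move=> x y; rewrite linear_sub // !rdotBr; ring.
- exists (2 * (rdot (f u) (f u) + D * rdot u u)) => x.
  have := rdot_CauchySchwarz u (g x); have := rdot_CauchySchwarz (f u) x.
  have := ler_wpM2r (rdot_ge0 u) (gD x).
  have := sqr_ge0 (rdot (f u) x + rdot u (g x)).
  nra.
- by move=> b Bb; rewrite fgB // subrr.
- by rewrite dB.
Qed.

Lemma bounded_scale H (a : R[i]) : bounded_op ( *:%R a : H -> H).
Proof.
apply/bounded_opP; split.
  by move=> b x y; rewrite scalerDr !scalerA mulrC.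
exists (complex.Re a ^+ 2 + complex.Im a ^+ 2);
  first by rewrite addr_ge0 ?sqr_ge0.
by move=> u; rewrite rdotZZ.
Qed.

Lemma closure_subspace H (W : set H) : is_subspace W -> is_subspace (closure W).
Proof.
move=> [W0 sW]; split; first exact: subset_closure.
move=> a x y Wx Wy; have {}Wx : closure W (a *: x).
  apply: (closure_image (bounded_scale H a) _ Wx) => z Wz;
    apply: subset_closure.
  exact: is_subspaceZ.
apply/closureP => e e0; have e4 : 0 < e / 4 by rewrite divr_gt0.
move: Wx Wy => /closureP/(_ _ e4)[x' Wx' xx'] /closureP/(_ _ e4)[y' Wy' yy'].
exists (x' + y'); first exact: is_subspaceD.
by rewrite opprD addrACA; have := rdotD_le (a *: x - x') (y - y'); lra.
Qed.

Lemma closure_complete H (W : set H) : complete_in (@rdot R H) (closure W).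
Proof.
move=> s Ws /rcauchy_cvg[l sl]; exists l => //; apply: closure_closed.
apply/closureP => e /sl[N Ne]; exists (s N) => //; exact: Ne.
Qed.

Lemma closed_projection H (W : set H) : is_subspace W ->
  exists2 p : H -> H,
    is_projection setT (@rdot R H) (closure W) p & bounded_op p.
Proof.
move=> sW; have sW' := closure_subspace sW.
have [p pP] := projection_op (rdot_inner_product H) sW' (@subsetT _ _)
  (@closure_complete _ W).
exists p => //; apply/bounded_opP; split.
  move=> a x y; exact: (proj_linear (rdot_inner_product H) sW' (@subsetT _ _)
    pP).
exists 1 => // u; rewrite mul1r.
exact: (proj_le (rdot_inner_product H) sW' (@subsetT _ _) pP).
Qed.

(** [W] is stable under multiplication by i, so the imaginary part of the product vanishes along
    with the real one. *)
Lemma orthC H (W : set H) d :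
  is_subspace W -> (forall z, W z -> rdot d z = 0) ->
  forall z, W z -> hdot z d = 0.
Proof.
move=> sW dW z Wz; rewrite hdotE rdotC dW //.
have -> : 'i *: d = conjc (- 'i) *: d by rewrite /= oppr0 opprK.
by rewrite -rdotZ rdotC dW //; apply: is_subspaceZ.
Qed.

(* Riesz representation of the functionals u |-> <f u, v>. *)
Lemma bounded_adjoint H (f : H -> H) : bounded_op f ->
  exists2 g, bounded_op g & adjoint f g.
Proof.
move=> bf; have [lf [C C0 fC]] := iffLR (bounded_opP f) bf.
have repr v : exists w, forall u, hdot (f u) v = hdot u w.
  (* The representing vector is sought orthogonal to the kernel of the functional, which is closed
     because [f] is bounded. *)
  pose W := [set u | hdot (f u) v = 0].
  have sW : is_subspace W.
    split; first by rewrite /W /= linear_zero // hdot0l.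
    by move=> a x y; rewrite /W /= lf hdotPl => -> ->; rewrite mulr0 addr0.
  have WW u : closure W u -> W u.
    move=> Wu; rewrite /W /= hdotE.
    have z0 w : (forall a, W a -> rdot (f a) w = 0) -> rdot (f u) w = 0.
      move=> Ww; apply: (@functional_closure _ (fun u => rdot (f u) w) W) => //.
        by move=> x y; rewrite linear_sub // rdotBl.
      exists (C * rdot w w) => x; apply: (le_trans (rdot_CauchySchwarz _ _)).
      by rewrite mulrAC ler_wpM2r ?rdot_ge0.
    by rewrite !z0 // => a; rewrite /W /= hdotE => -[].
  have [[u0 fu0]|nu0] := pselect (exists u0, ~ W u0); last first.
    exists 0 => u; rewrite hdot0r; apply: contrapT => nu; apply: nu0.
    by exists u.
  have [p pP _] := closed_projection sW.
  have [/WW Wpu0 pu0] := pP u0 I; pose d := u0 - p u0.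
  have Wd : forall z, W z -> hdot z d = 0.
    by apply: orthC => // z Wz; apply: pu0; apply: subset_closure.
  have fd : hdot (f d) v != 0.
    apply/eqP => Wd0; apply: fu0; rewrite -(subrK (p u0) u0).
    exact: is_subspaceD.
  pose al := hdot (f d) v.
  (* [u] and (hdot (f u) v / al) d agree modulo the kernel, to which [d] is orthogonal. Hence <u, d>
     = (hdot (f u) v / al) <d, d>, and the factor undoes this scaling. *)
  exists (Num.conj (al / hdot d d) *: d) => u.
  have : W (u - (hdot (f u) v / al) *: d).
    rewrite /W /= linear_sub // linear_scale // hdotBl hdotZl.
    by rewrite divfK // subrr.
  move=> /Wd; rewrite hdotBl hdotZl => /subr0_eq ud.
  rewrite hdotZr conjCK ud.
  have dd : hdot d d != 0.
    rewrite dnorm_eq0; apply: contraNneq fd => ->.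
    by rewrite linear_zero // hdot0l.
  by rewrite /al; field; rewrite fd dd.
have [g gP] := choice repr; have fg : radjoint f g by move=> u v;
  rewrite /rdot gP.
have lg : linear g.
  move=> a x y; have key z : rdot z (g (a *: x + y)) = rdot z (a *: g x + g y).
    rewrite -fg !rdotDr -fg; congr (_ + _); rewrite -[a]conjcK -!rdotZ -fg.
    by rewrite linear_scale.
  by apply/eqP; rewrite -subr_eq0; apply/eqP/rdot_eq0; rewrite rdotBr key subrr.
exists g; last exact/adjointP.
apply/bounded_opP; split=> //; exists C => // v.
have [->|gv0] := eqVneq (g v) 0; first by rewrite rdot0l mulr_ge0 ?rdot_ge0.
have gp : 0 < rdot (g v) (g v).
  by rewrite lt_neqAle rdot_ge0 andbT eq_sym;
    apply: contraNneq gv0 => /rdot_eq0 ->.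
(* <g v, g v> = <f (g v), v>, so its square is at most C <g v, g v> <v, v>; one factor cancels. *)
have := rdot_CauchySchwarz (f (g v)) v; rewrite fg => h.
rewrite -(ler_pM2l gp) -expr2 (le_trans h) // mulrCA mulrA.
by rewrite ler_wpM2r ?rdot_ge0.
Qed.

End Hilbert.

(** * Square-summable sequences *)

Section SquareSummable.
Variables (R : realType) (H : hilbertType R).
Implicit Types (u v : nat -> H) (f : H -> H).

Definition l2 u :=
  exists B : R, forall n, \sum_(0 <= k < n) rdot (u k) (u k) <= B.

Definition l2dot u v : R := limn (series (fun n => rdot (u n) (v n))).

Lemma l2_cvg_norm u : l2 u -> cvgn (series (fun n => rdot (u n) (u n))).
Proof.
move=> [B uB]; apply: nondecreasing_is_cvgn.
  by apply: nondecreasing_series => n _ _; apply: rdot_ge0.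
by exists B => _ [n _ <-]; apply: uB.
Qed.

Lemma l2_cvg u v : l2 u -> l2 v -> cvgn (series (fun n => rdot (u n) (v n))).
Proof.
move=> [B uB] [C vC]; apply: normed_cvg.
apply: nondecreasing_is_cvgn.
  by apply: nondecreasing_series => n _ _; apply: normr_ge0.
exists (B + C) => _ [n _ <-]; apply: le_trans (lerD (uB n) (vC n)).
rewrite -big_split; apply: ler_sum => k _.
have := rdot_CauchySchwarz (u k) (v k).
have := rdot_ge0 (u k); have := rdot_ge0 (v k).
rewrite ler_norml /=.
have := rdot_ge0 (u k - v k); have := rdot_ge0 (u k + v k).
rewrite !(rdotDl, rdotDr, rdotNl, rdotNr) (rdotC (v k)); lra.
Qed.

Lemma l2_sum_le u n : l2 u -> \sum_(0 <= k < n) rdot (u k) (u k) <= l2dot u u.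
Proof.
move=> /l2_cvg_norm cu; apply: nondecreasing_cvgn_le cu n.
by apply: nondecreasing_series => n _ _; apply: rdot_ge0.
Qed.

Lemma l2_coord_le u k : l2 u -> rdot (u k) (u k) <= l2dot u u.
Proof.
move=> lu; apply: le_trans (l2_sum_le k.+1 lu).
by rewrite big_nat_recr //= lerDr sumr_ge0 // => i _; apply: rdot_ge0.
Qed.

Lemma l2dot_le u B : (forall n, \sum_(0 <= k < n) rdot (u k) (u k) <= B) ->
  l2dot u u <= B.
Proof.
move=> uB; apply: limr_le; first by apply: l2_cvg_norm; exists B.
by apply: nearW.
Qed.

Lemma l2_subspace : is_subspace l2.
Proof.
split; first by exists 0 => n; rewrite big1 // => k _; rewrite rdot0l.
move=> a x y [B xB] [C yC].
pose c := complex.Re a ^+ 2 + complex.Im a ^+ 2.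
exists (2 * c * B + 2 * C) => n.
have c0 : 0 <= 2 * c by rewrite mulr_ge0 // addr_ge0 ?sqr_ge0.
have := ler_wpM2l c0 (xB n); have := ler_wpM2l (ler0n R 2) (yC n) => h1 h2.
apply: le_trans (lerD h2 h1); rewrite !mulr_sumr -big_split /=.
apply: ler_sum => k _; rewrite -mulrA -rdotZZ; exact: rdotD_le.
Qed.

Lemma l2_inner_product : inner_product l2 l2dot.
Proof.
split; first exact: l2_subspace.
- by move=> x y _ _; congr (limn _); apply/funext => n; apply: eq_bigr => k _;
  apply: rdotC.
- move=> t x y z lx ly lz; rewrite /l2dot.
  have -> : series (fun n => rdot ((t%:C *: x + y) n) (z n)) =
      t *: series (fun n => rdot (x n) (z n)) +
      series (fun n => rdot (y n) (z n)).
    apply/funext => n; rewrite /series /= !fctE scaler_sumr -big_split /=.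
    by apply: eq_bigr => k _; rewrite rdotDl rdotZl.
  have cx := l2_cvg lx lz; have cy := l2_cvg ly lz.
  by apply/cvg_lim => //; apply: cvgD => //; apply: cvgZ => //; apply: cvg_cst.
- by move=> a x y _ _; congr (limn _); apply/funext => n;
  apply: eq_bigr => k _; apply: rdotZ.
- by move=> x lx; have := l2_sum_le 0 lx; rewrite big_geq.
- move=> x lx x0; apply/funext => k; apply: rdot_eq0; apply/eqP.
  by rewrite eq_le rdot_ge0 andbT -x0 l2_coord_le.
Qed.

Lemma l2_complete (s : nat -> nat -> H) : (forall n, l2 (s n)) ->
  rcauchy l2dot s -> exists2 l, l2 l & rcvg l2dot s l.
Proof.
move=> ls cs.
have ls2 m n : l2 (s m - s n) by apply: is_subspaceB => //; apply: l2_subspace.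
have coord_cvg k : exists l, rcvg (@rdot R H) (s ^~ k) l.
  apply: rcauchy_cvg => e /cs[N Ne]; exists N => m n Nm Nn.
  exact: le_lt_trans (l2_coord_le k (ls2 m n)) (Ne m n Nm Nn).
have [l lP] := choice coord_cvg.
have sum_cvg M (e : R) : 0 < e -> exists N, forall n, (N <= n)%N ->
    \sum_(0 <= k < M) rdot (l k - s n k) (l k - s n k) < e.
  elim: M e => [|M IH] e e0; first by exists 0 => n _; rewrite big_geq.
  have e2 : 0 < e / 2 by rewrite divr_gt0.
  have [N1 N1e] := IH _ e2; have [N2 N2e] := lP M _ e2.
  exists (maxn N1 N2) => n; rewrite geq_max => /andP[n1 n2].
  by rewrite big_nat_recr //=; have := N1e n n1; have := N2e n n2; lra.
have tail e : 0 < e -> exists N, forall n, (N <= n)%N -> forall M,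
    \sum_(0 <= k < M) rdot (l k - s n k) (l k - s n k) <= e.
  move=> e0; have [|N Ne] := cs (e / 4); first by rewrite divr_gt0.
  exists N => n Nn M.
  have [|N' N'e] := sum_cvg M (e / 4); first by rewrite divr_gt0.
  (* The limit is known only coordinatewise, so [m] depends on [M]; the Cauchy bound on s m - s n
     does not, and the resulting estimate is uniform in [M]. *)
  pose m := maxn N N'.
  have := N'e m (leq_maxr _ _).
  have := le_lt_trans (l2_sum_le M (ls2 m n)) (Ne m n (leq_maxl _ _) Nn).
  have : \sum_(0 <= k < M) rdot (l k - s n k) (l k - s n k) <=
     2 * \sum_(0 <= k < M) rdot (l k - s m k) (l k - s m k) +
     2 * \sum_(0 <= k < M) rdot ((s m - s n) k) ((s m - s n) k).
    by rewrite !mulr_sumr -big_split /=; apply: ler_sum => k _; apply: rdotB_le.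
  lra.
exists l.
  have [N Nl] := tail 1 ltr01.
  have lsN : l2 (l - s N) by exists 1; apply: Nl.
  by rewrite -[l](subrK (s N)); apply: is_subspaceD l2_subspace lsN (ls N).
move=> e e0; have [|N Nl] := tail (e / 2); first by rewrite divr_gt0.
exists N => n Nn; apply: (@le_lt_trans _ _ (e / 2)); last by lra.
by apply: l2dot_le; apply: Nl.
Qed.

Lemma l2_op f u : bounded_op f -> l2 u -> l2 (f \o u).
Proof.
move=> /bounded_opP[_ [C C0 fC]] [B uB]; exists (C * B) => n.
apply: (le_trans _ (ler_wpM2l C0 (uB n))); rewrite mulr_sumr.
by apply: ler_sum => k _; apply: fC.
Qed.

Lemma l2dot_op f : bounded_op f -> exists2 C : R, 0 <= C &
  forall u, l2 u -> l2dot (f \o u) (f \o u) <= C * l2dot u u.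
Proof.
move=> /bounded_opP[_ [C C0 fC]]; exists C => // u lu; apply: l2dot_le => n.
apply: (le_trans _ (ler_wpM2l C0 (l2_sum_le n lu))); rewrite mulr_sumr.
by apply: ler_sum => k _; apply: fC.
Qed.

Lemma l2dot_adj f g u v : radjoint f g -> l2dot (f \o u) v = l2dot u (g \o v).
Proof.
move=> fg; congr (limn _); apply/funext => n.
by apply: eq_bigr => k _; apply: fg.
Qed.

Definition single j (h : H) : nat -> H := fun n => if n == j then h else 0.

Lemma l2dot_singler u j h : l2dot u (single j h) = rdot (u j) h.
Proof.
rewrite /l2dot; apply/cvg_lim => //.
apply: cvg_near_cst; exists j.+1 => // n /= jn; rewrite /series /=.
rewrite big_mkord (bigD1 (Ordinal jn)) //= /single eqxx big1 ?addr0 // => i.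
by rewrite -val_eqE /= => /negPf ->; rewrite rdot0r.
Qed.

Lemma l2_single j h : l2 (single j h).
Proof.
exists (rdot h h) => n; have [jn|nj] := ltnP j n; last first.
  rewrite big_nat big1 ?rdot_ge0 // => i /andP[_ ilt].
  by rewrite /single ltn_eqF ?rdot0l // (leq_trans ilt).
rewrite big_mkord (bigD1 (Ordinal jn)) //= /single eqxx big1 ?addr0 // => i.
by rewrite -val_eqE /= => /negPf ->; rewrite rdot0r.
Qed.

Lemma single_linear j a x y :
  single j (a *: x + y) = a *: single j x + single j y.
Proof.
apply/funext => n; rewrite !fctE /single; case: ifP => // _.
by rewrite scaler0 addr0.
Qed.

Lemma single_op j f h : linear f -> single j (f h) = f \o single j h.
Proof.
by move=> lf; apply/funext => n; rewrite /single /=; case: ifP;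
  rewrite ?linear_zero.
Qed.

End SquareSummable.

(** * The double commutant theorem *)

Section DoubleCommutant.
Variables (R : realType) (H : hilbertType R) (A : set (H -> H)).
Hypothesis sA : unital_star_subalgebra (@bounded_op R H H) A.
Variables (v : nat -> H) (lv : l2 v).

Let l2P := l2_inner_product H.

(** The closure of the orbit of [v] under A acting diagonally on l2(H). Taking a sequence rather
    than a vector of H lets the result meet the infinite sums in a normal trace. *)
Definition orbit_closure : set (nat -> H) := [set w | l2 w /\
  forall e : R, 0 < e ->
    exists2 a, A a & l2dot (w - (a \o v)) (w - (a \o v)) < e].

Let A_bounded a : A a -> bounded_op a. Proof. exact: (subalg_sub sA). Qed.

Let lav a : A a -> l2 (a \o v).
Proof. by move=> Aa; apply: l2_op => //; apply: A_bounded. Qed.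

Lemma comp_linear_sub (f : H -> H) (u w : nat -> H) : linear f ->
  f \o (u - w) = (f \o u) - (f \o w).
Proof. by move=> lf; apply/funext => n; rewrite /= !fctE linear_sub. Qed.

Lemma orbit_subspace : is_subspace orbit_closure.
Proof.
split.
  split=> [|e e0]; first exact: (l2_subspace H).1.
  exists 0.
    have := subalg_linear sA (-1) (subalg_one sA) (subalg_one sA).
    by rewrite scaleN1r addNr.
  by rewrite subr0 (inner0l l2P) //; exact: (l2_subspace H).1.
move=> c x y [lx Wx] [ly Wy]; split; first exact: (l2_subspace H).2.
move=> e e0; pose k := complex.Re c ^+ 2 + complex.Im c ^+ 2.
have k0 : 0 <= k by rewrite addr_ge0 ?sqr_ge0.
have [|a Aa ax] := Wx (e / 4 / (k + 1)); first by rewrite !divr_gt0 // ltr_pwDr.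
have [|b Ab bx] := Wy (e / 4); first by rewrite divr_gt0.
exists (c *: a + b); first exact: (subalg_linear sA).
have lxa : l2 (x - (a \o v)) by apply: is_subspaceB => //;
  [exact: l2_subspace|exact: lav].
have lyb : l2 (y - (b \o v)) by apply: is_subspaceB => //;
  [exact: l2_subspace|exact: lav].
have -> : c *: x + y - ((c *: a + b) \o v) =
    c *: (x - (a \o v)) + (y - (b \o v)).
  by apply/funext => n; rewrite /= !fctE scalerBr opprD addrACA.
have := innerD_le l2P (is_subspaceZ c (l2_subspace H) lxa) lyb.
rewrite (innerZZ l2P) // -/k => /le_lt_trans; apply.
move: ax; rewrite ltr_pdivlMr ?ltr_pwDr // => ax.
have := inner_ge0 l2P lxa; lra.
Qed.

Lemma orbit_complete : complete_in (@l2dot R H) orbit_closure.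
Proof.
move=> s Ws cs; have [l ll sl] := l2_complete (fun n => (Ws n).1) cs.
exists l => //; split=> // e e0; have e4 : 0 < e / 4 by rewrite divr_gt0.
have [N Ne] := sl _ e4; have [a Aa ae] := (Ws N).2 _ e4; exists a => //.
have := innerB_le l2P ll (Ws N).1 (lav Aa); have := Ne N (leqnn N); lra.
Qed.

Lemma orbit_op b w : A b -> orbit_closure w -> orbit_closure (b \o w).
Proof.
move=> Ab [lw Ww]; have bb := A_bounded Ab; split; first exact: l2_op.
move=> e e0; have [C C0 bC] := l2dot_op bb.
have [|a Aa ae] := Ww (e / (C + 1)); first by rewrite divr_gt0 // ltr_pwDr.
exists (b \o a); first exact: (subalg_mul sA).
have lwa : l2 (w - (a \o v)) by apply: is_subspaceB => //;
  [exact: l2_subspace|exact: lav].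
rewrite -[(b \o a) \o v]/(b \o (a \o v)) -comp_linear_sub; last by case: bb.
apply: (le_lt_trans (bC _ lwa)); move: ae;
  rewrite ltr_pdivlMr ?ltr_pwDr // => ae.
have := inner_ge0 l2P lwa; lra.
Qed.

(* The projection of l2(H) onto the orbit closure is a matrix of operators in
   the commutant of A, so that it commutes with the double commutant. *)
Lemma double_commutant_orbit x x' : commutant (commutant A) x ->
  commutant (commutant A) x' -> radjoint x x' -> orbit_closure (x \o v).
Proof.
move=> [bx xA] [bx' xA'] xx'.
have W_l2 : orbit_closure `<=` @l2 R H by move=> w [].
have [p pP] := projection_op l2P orbit_subspace W_l2 orbit_complete.
have pl := proj_linear l2P orbit_subspace W_l2 pP.
have Wv : orbit_closure v.
  split=> // e e0; exists idfun; first exact: (subalg_one sA).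
  by rewrite (_ : _ - _ = 0) ?(inner0l l2P) //;
    [exact: (l2_subspace H).1|exact: subrr].
pose y i j h := p (single j h) i.
have yA i j : commutant A (y i j).
  split.
    apply/bounded_opP; split.
      by move=> c g h; rewrite /y single_linear pl //; apply: l2_single.
    exists 1 => // h; rewrite mul1r.
    have <- : l2dot (single j h) (single j h) = rdot h h.
      by rewrite l2dot_singler /single eqxx.
    have lph := W_l2 _ (proj_in pP (l2_single j h)).
    apply: (le_trans (l2_coord_le i lph)).
    by apply: (proj_le l2P orbit_subspace W_l2 pP); apply: l2_single.
  move=> b Ab; have [b' Ab' bb'] := subalg_star sA Ab.
  have [lb _] := A_bounded Ab; have [lb' _] := A_bounded Ab'.
  apply/funext => h /=; rewrite /y single_op //.
  rewrite (@proj_comm _ _ _ _ l2P _ _ orbit_subspace W_l2 pP (fun w => b \o w)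
    (fun w => b' \o w)) //.
  - by move=> ? ? _ _; apply: comp_linear_sub.
  - by move=> w lw; apply: l2_op => //; apply: A_bounded.
  - by move=> ? ? _ _; apply: l2dot_adj; apply/adjointP.
  - by move=> w; apply: orbit_op.
  - by move=> w; apply: orbit_op.
  - exact: l2_single.
have lxv : l2 (x \o v) by exact: l2_op.
have [Wp pxv] := pP _ lxv.
suff -> : x \o v = p (x \o v) by [].
apply/eqP; rewrite -subr_eq0; apply/eqP/funext => j; apply: rdot_eq0.
(* Testing [z] on [single j h] avoids multiplying infinite matrices. The part of [single j h] in the
   orbit closure is orthogonal to [z]. On the other part [z] pairs like x v; since x' commutes with
   the entries of [p], it maps this part to another vector orthogonal to the orbit closure, which
   contains v. *)
set z := (x \o v) - _; set h := z j.
have lz : l2 z by apply: is_subspaceB => //; [exact: l2_subspace|exact: W_l2].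
have lh : l2 (single j h) by exact: l2_single.
have Wph := proj_in pP lh; have lph := W_l2 _ Wph.
have ld := is_subspaceB (l2_subspace H) lh lph.
rewrite -l2dot_singler -[single j h](subrK (p (single j h))).
rewrite (innerC l2P) // ?subrK // -[X in l2dot X _](subrK (p (single j h))).
rewrite (innerDl l2P) // (innerC l2P lph) // pxv // addr0 (innerC l2P) //.
rewrite /z (innerBl l2P) // ?(innerC l2P (W_l2 _ Wp)) //; last exact: W_l2.
rewrite (proj_orth pP) // subr0 (l2dot_adj _ _ xx') (innerC l2P) //;
  last exact: l2_op.
have -> : x' \o (single j h - p (single j h)) =
    single j (x' h) - p (single j (x' h)).
  rewrite comp_linear_sub -?single_op; try by case: bx'.
  congr (_ - _); apply/funext => i /=.
  by have /(congr1 (fun f => f h)) := xA' _ (yA i j).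
by rewrite (proj_orth pP) //; apply: l2_single.
Qed.

End DoubleCommutant.

(** * Passage between complex and real series *)

Section ComplexSequences.
Variable (R : realType).

Lemma cvg_Re (u : nat -> R[i]^o) (z : R[i]^o) : u @ \oo --> z ->
  (fun n => complex.Re (u n)) @ \oo --> complex.Re z.
Proof.
move=> /cvgrPdist_lt uz; apply/cvgrPdist_lt => e e0.
have /uz[N _ Ne] : 0 < e%:C by rewrite ltcR.
exists N => // n Nn; rewrite -ltcR; apply: le_lt_trans (Ne n Nn).
apply: le_trans (normc_ge_Re _); rewrite lecR.
by rewrite ReD ReN.
Qed.

Lemma cvg_real_complex (u : nat -> R) (l : R) : u @ \oo --> l ->
  (fun n => (u n)%:C : R[i]^o) @ \oo --> (l%:C : R[i]^o).
Proof.
move=> /cvgrPdist_lt ul; apply/cvgrPdist_lt => _/gt0_complex[e e0 ->].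
have [N _ Ne] := ul e e0.
exists N => // n Nn; rewrite /= -rmorphB /=.
rewrite normc_def /= expr0n addr0 sqrtr_sqr ltcR; exact: Ne.
Qed.

Lemma Re_sum (f : nat -> R[i]) n :
  complex.Re (\sum_(0 <= k < n) f k) = \sum_(0 <= k < n) complex.Re (f k).
Proof. by apply: (big_morph _ (@ReD R)). Qed.

Lemma square_summableP (H : hilbertType R) (u : nat -> H) :
  square_summable u <-> l2 u.
Proof.
have E : series (fun n => `|u n| ^+ 2 : R[i]^o) =
    (fun n => (series (fun n => rdot (u n) (u n)) n)%:C : R[i]^o).
  apply/funext => n; rewrite /series /= rmorph_sum.
  by apply: eq_bigr => k _; rewrite normr_rdot.
rewrite /square_summable E; split=> [/cvg_ex[z /cvg_Re/= uz]|/l2_cvg_norm lu].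
  exists (complex.Re z) => n.
  rewrite -(cvg_lim _ uz) //; apply: nondecreasing_cvgn_le (cvgP _ uz) n.
  by apply: nondecreasing_series => k _ _; apply: rdot_ge0.
by apply/cvg_ex; eexists; apply: cvg_real_complex; apply: lu.
Qed.

End ComplexSequences.

(** * Adjoints, commutants and generated von Neumann algebras *)

Section VonNeumann.
Variables (R : realType) (H : hilbertType R).
Implicit Types (A B M : set (H -> H)) (x y : H -> H).

Lemma adjoint_uniq x y z : adjoint x y -> adjoint x z -> y = z.
Proof.
move=> xy xz; apply/funext => u; apply/eqP; rewrite -subr_eq0.
by apply/eqP/rdot_eq0; rewrite rdotBr /rdot -xy -xz subrr.
Qed.

Lemma adjointC x y : adjoint x y -> adjoint y x.
Proof.
move=> xy u v; rewrite hermC expr0 mul1r /= -xy.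
by rewrite [RHS]hermC expr0 mul1r.
Qed.

Lemma adjoint_comp x x' y y' : adjoint x x' -> adjoint y y' ->
  adjoint (x \o y) (y' \o x').
Proof. by move=> xx' yy' u v; rewrite /= xx' yy'. Qed.

Lemma adjoint_linear a x x' y y' : adjoint x x' -> adjoint y y' ->
  adjoint (a *: x + y) (Num.conj a *: x' + y').
Proof.
by move=> xx' yy' u v; rewrite !fctE hdotPl hdotDr hdotZr conjCK xx' yy'.
Qed.

Lemma adjointB x x' y y' : adjoint x x' -> adjoint y y' ->
  adjoint (x - y) (x' - y').
Proof.
move=> xx' yy'; have := adjoint_linear (-1) yy' xx'.
by rewrite rmorphN1 !scaleN1r addrC [- y' + _]addrC.
Qed.

Lemma commutant_anti A B : A `<=` B -> commutant B `<=` commutant A.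
Proof. by move=> AB y [by_ yB]; split=> // x /AB/yB. Qed.

Lemma sub_bicommutant A :
  A `<=` @bounded_op R H H -> A `<=` commutant (commutant A).
Proof.
by move=> bA x Ax; split; [exact: bA|by move=> y [_ yA]; rewrite yA].
Qed.

Lemma commutant_bounded A : commutant A `<=` @bounded_op R H H.
Proof. by move=> x []. Qed.

(** An element of A'' has an adjoint because A'' lies in M. This adjoint stays in A'' because A' is
    closed under adjoints, whose existence is [bounded_adjoint]. *)
Lemma von_neumann_bicommutant M A : von_neumann M -> A `<=` M ->
  (forall x, A x -> exists2 y, A y & adjoint x y) ->
  von_neumann (commutant (commutant A)).
Proof.
move=> [bM starM cM] AM starA.
have A''M : commutant (commutant A) `<=` M.
  by rewrite -[X in _ `<=` X]cM; do 2 apply: commutant_anti.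
split; first exact: commutant_bounded.
  move=> x A''x; have [x' Mx' xx'] := starM _ (A''M _ A''x).
  exists x' => //; split; first exact: bM.
  move=> y A'y; have [y' by' yy'] := bounded_adjoint (commutant_bounded A'y).
  have A'y' : commutant A y'.
    split=> // a Aa; have [a' Aa' aa'] := starA _ Aa.
    apply: (@adjoint_uniq (y \o a')); last by rewrite -(A'y.2 _ Aa');
      apply: adjoint_comp => //; apply: adjointC.
    by apply: adjoint_comp => //; apply: adjointC.
  apply: (@adjoint_uniq (x \o y')); last by rewrite -(A''x.2 _ A'y');
    apply: adjoint_comp => //; apply: adjointC.
  by apply: adjoint_comp => //; apply: adjointC.
rewrite eqEsubset; split.
  by apply: commutant_anti; apply: sub_bicommutant; apply: commutant_bounded.
by apply: sub_bicommutant; apply: commutant_bounded.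
Qed.

Lemma smallest_bicommutant M A : von_neumann M -> A `<=` M ->
  (forall x, A x -> exists2 y, A y & adjoint x y) ->
  smallest (@von_neumann R H) A `<=` commutant (commutant A).
Proof.
move=> vM AM starA; apply: smallest_sub;
  first exact: von_neumann_bicommutant vM _ _.
by apply: sub_bicommutant => x /AM; case: vM => + _ _; apply.
Qed.

(** [smallest] is an intersection. Its member M provides boundedness and adjoints, and uniqueness of
    the adjoint puts it in every other member. *)
Lemma smallest_von_neumann M A : von_neumann M -> A `<=` M ->
  von_neumann (smallest (@von_neumann R H) A).
Proof.
move=> vM AM; have sM : smallest (@von_neumann R H) A `<=` M by apply:
  smallest_sub.
split.
- by move=> x /sM; case: vM => + _ _; apply.
- move=> x Qx; have [x' Mx' xx'] : exists2 x', M x' & adjoint x x'.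
    by case: vM => _ + _; apply; apply: sM.
  exists x' => // B [vB AB]; case: (vB) => _ starB _.
  have [x'' Bx'' xx''] := starB x (Qx B (conj vB AB)).
  by rewrite (adjoint_uniq xx' xx'').
rewrite eqEsubset; split.
  move=> x Q''x B [vB AB]; case: (vB) => _ _ <-.
  apply: (commutant_anti _ Q''x); apply: commutant_anti => y; apply.
  by split.
by apply: sub_bicommutant => x /sM; case: vM => + _ _; apply.
Qed.

(** Lying in a double commutant is a commutation property, stable under linear combinations and
    products. *)
Lemma von_neumann_subalgebra M A : von_neumann A -> A `<=` M ->
  unital_star_subalgebra M A.
Proof.
move=> [bA starA cA] AM; split=> //.
- by rewrite -cA; split; [exact: bounded_id|].
- move=> a x y Ax Ay; have [lx cx] := bA _ Ax; have [ly cy] := bA _ Ay.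
  rewrite -cA; split.
    split; last by move=> u; apply: cvgD; [apply: cvgZ;
      [exact: cvg_cst|exact: cx]|exact: cy].
    move=> b u v; rewrite !fctE lx ly !scalerDr !scalerA mulrC.
    by rewrite addrACA.
  move=> z A'z; have [lz _] := commutant_bounded A'z.
  apply/funext => u /=; rewrite !fctE lz.
  move: A'z => [_ A'z]; have /(congr1 (fun f => f u))/= <- := A'z _ Ax.
  by have /(congr1 (fun f => f u))/= <- := A'z _ Ay.
- move=> x y Ax Ay; rewrite -cA; split; first by apply: bounded_comp; apply: bA.
  move=> z [_ A'z]; apply/funext => u /=.
  have /(congr1 (fun f => f (y u)))/= <- := A'z _ Ax.
  by have /(congr1 (fun f => f u))/= <- := A'z _ Ay.
Qed.

End VonNeumann.

(** * L^2-density of a star-algebra in the von Neumann algebra it generates *)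

Section Density.
Variables (R : realType) (H : hilbertType R) (M : set (H -> H)).
Variables (tau : (H -> H) -> R[i]) (hM : von_neumann M).
Variables (htau : tracial_state M tau) (L : gns M tau).

(* Polarizing the normal expression of tau makes the sum of its vectors
   dominate the trace norm. *)
Lemma vec_l2_bound : exists2 v : nat -> H, l2 v &
  forall x, M x -> rdot (vec L x) (vec L x) <= l2dot (x \o v) (x \o v).
Proof.
have [xi [eta [/square_summableP sxi /square_summableP seta tauE]]] :=
  trace_normal htau.
have lv : l2 (xi + eta) by apply: is_subspaceD => //; apply: l2_subspace.
exists (xi + eta) => // x Mx; have [bM starM _] := hM; have bx := bM _ Mx.
have [x' Mx' xx'] := starM _ Mx; have bx' := bM _ Mx'.
rewrite /rdot (vec_dot L Mx Mx xx').
have Mx'x : M (x' \o x) := subalg_mul (von_neumann_subalgebra hM (@subset_refl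
  _ M)) Mx' Mx.
have /cvg_Re/= cRe := tauE _ Mx'x.
rewrite -(cvg_lim _ cRe) //; apply: limr_le; first exact: cvgP cRe.
apply: nearW => n; have lxv := l2_op bx lv.
apply: le_trans (l2_sum_le n lxv); rewrite Re_sum; apply: ler_sum => k _.
rewrite (adjointC xx') -/(rdot _ _) /=.
have [lx _] := bx; have -> : x ((xi + eta) k) = x (xi k) + x (eta k).
  exact: linear_add.
(* 4 Re <a, b> = |a + b|^2 - |a - b|^2, so that Re <a, b> <= |a + b|^2. *)
have := rdot_ge0 (x (xi k) - x (eta k));
  have := rdot_ge0 (x (xi k) + x (eta k)).
rewrite !(rdotDl, rdotDr, rdotNl, rdotNr) (rdotC (x (eta k)) (x (xi k))); lra.
Qed.

(** [double_commutant_orbit] approximates x v by a v in l2(H), and [vec_l2_bound] turns this into an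
    approximation of x by a in the trace norm. *)
Lemma vec_dense_smallest A x : unital_star_subalgebra M A ->
  smallest (@von_neumann R H) A x -> closure (vec L @` A) (vec L x).
Proof.
move=> sA Nx; have [v lv vP] := vec_l2_bound.
have AM := subalg_sub sA; have starA := subalg_star sA.
have sM : smallest (@von_neumann R H) A `<=` M by apply: smallest_sub.
have A'' := smallest_bicommutant hM AM starA.
have [bM _ _] := hM.
have [_ starN _] := smallest_von_neumann hM AM.
have [x' Nx' xx'] := starN _ Nx.
have sbA : unital_star_subalgebra (@bounded_op R H H) A.
  by case: sA => ? ? ? ? ?; split=> // y /AM/bM.
have rxx' : radjoint x x' by apply/adjointP => //; case: (bM _ (sM _ Nx')).
have [_ approx] := double_commutant_orbit sbA lv (A'' _ Nx) (A'' _ Nx') rxx'.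
apply/closureP => e /approx[a Aa ae]; exists (vec L a); first by exists a.
have Ma := AM _ Aa; have Mx := sM _ Nx.
have Mxa : M (x - a).
  have := subalg_linear (von_neumann_subalgebra hM (@subset_refl _ M)) (-1) Ma
    Mx.
  by rewrite scaleN1r addrC.
have <- : vec L (x - a) = vec L x - vec L a.
  by rewrite addrC -scaleN1r (vec_linear L) // scaleN1r addrC.
exact: le_lt_trans (vP _ Mxa) _.
Qed.

End Density.

(** * Tensor products and direct sums *)

Section Tensor.
Variables (R : realType) (H K : hilbertType R) (T : hilbert_tensor H K).

Lemma tensor_sums_ind (V : set H) (W : set K) (P : T -> Prop) :
  P 0 -> (forall s t, P s -> P t -> P (s + t)) ->
  (forall a b, V a -> W b -> P (tens T a b)) ->
  forall t, tensor_sums (tens T) V W t -> P t.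
Proof.
move=> P0 PD Pab _ [n [a [b [ab ->]]]]; apply: big_ind => // i _.
by have [Va Wb] := ab i; apply: Pab.
Qed.

Lemma tensor_op_ext (X : hilbertType R) (f g : T -> X) : bounded_op f ->
  bounded_op g -> (forall a b, f (tens T a b) = g (tens T a b)) -> f = g.
Proof.
move=> bf bg fg; have [lf _] := bf; have [lg _] := bg; apply/funext => t.
apply: (eq_closure bf bg (A := tensor_sums (tens T) setT setT)); last first.
  by rewrite tens_dense.
apply: tensor_sums_ind => //; first by rewrite !linear_zero.
by move=> s u fs fu; rewrite !linear_add // fs fu.
Qed.

Lemma top_comp A A' B B' : bounded_op A -> bounded_op A' ->
  bounded_op B -> bounded_op B' ->
  top T (A \o A') (B \o B') = top T A B \o top T A' B'.
Proof.
move=> bA bA' bB bB'; have bAA := bounded_comp bA bA'.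
have bBB := bounded_comp bB bB'.
apply: tensor_op_ext; first exact: top_bounded.
  by apply: bounded_comp; apply: top_bounded.
by move=> a b; rewrite /= !top_tens.
Qed.

Lemma top_id : top T idfun idfun = idfun.
Proof.
have bH := bounded_id H; have bK := bounded_id K.
apply: tensor_op_ext; [exact: top_bounded|exact: bounded_id|].
by move=> a b; rewrite top_tens.
Qed.

Lemma top_adjoint A A' B B' : bounded_op A -> bounded_op A' ->
  bounded_op B -> bounded_op B' -> radjoint A A' -> radjoint B B' ->
  radjoint (top T A B) (top T A' B').
Proof.
move=> bA bA' bB bB' AA' BB'.
have [lA' _] := bA'; have [lB' _] := bB'.
have hA a c : hdot (A a) c = hdot a (A' c) by rewrite !hdotE !AA' linear_scale.
have hB a c : hdot (B a) c = hdot a (B' c) by rewrite !hdotE !BB' linear_scale.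
have bT := top_bounded T bA bB; have bT' := top_bounded T bA' bB'.
have [lT _] := bT; have [lT' _] := bT'.
apply: radjoint_dense bT bT' (tens_dense T) (tens_dense T) _ => t s Dt Ds.
move: t Dt; apply: tensor_sums_ind.
- by rewrite linear_zero // !rdot0l.
- by move=> t u tP uP; rewrite linear_add // !rdotDl tP uP.
move=> a b _ _; move: s Ds; apply: tensor_sums_ind.
- by rewrite linear_zero // !rdot0r.
- by move=> t u tP uP; rewrite linear_add // !rdotDr tP uP.
by move=> c d _ _; rewrite !top_tens // /rdot !tens_dot hA hB.
Qed.

Lemma rdot_tens a b : rdot (tens T a b) (tens T a b) = rdot a a * rdot b b.
Proof.
apply: (@complexI R); rewrite -normr_rdot hdot_norm tens_dot.
by rewrite -!hdot_norm !normr_rdot rmorphM.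
Qed.

Lemma tens_boundedl b : bounded_op (tens T ^~ b).
Proof.
apply/bounded_opP; split; first exact: tens_linearl.
by exists (rdot b b) => [|a]; rewrite ?rdot_ge0 // rdot_tens mulrC.
Qed.

Lemma tens_boundedr a : bounded_op (tens T a).
Proof.
apply/bounded_opP; split; first exact: tens_linearr.
by exists (rdot a a) => [|b]; rewrite ?rdot_ge0 // rdot_tens.
Qed.

Lemma tensor_orth (V : set H) (W : set K) t : closure V = setT ->
  closure W = setT -> (forall a b, V a -> W b -> rdot t (tens T a b) = 0) -> t
    = 0.
Proof.
move=> dV dW tVW; apply: orth_dense (tens_dense T) _.
have orth_op (X : hilbertType R) (f : X -> T) (E : set X) u : bounded_op f ->
    closure E = setT -> (forall a, E a -> rdot t (f a) = 0) -> rdot t (f u) = 0.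
  move=> bf dE fE; apply: (orth_closure (A := f @` E)).
    by move=> _ [a Ea <-]; apply: fE.
  apply: (closure_image bf (A := E)); last by rewrite dE.
  by move=> a Ea; apply: subset_closure; exists a.
apply: tensor_sums_ind; first by rewrite rdot0r.
  by move=> s u ts tu; rewrite rdotDr ts tu addr0.
move=> a b _ _; apply: (orth_op _ _ W _ (tens_boundedr a) dW) => d Wd.
by apply: (orth_op _ _ V _ (tens_boundedl d) dV) => c Vc; apply: tVW.
Qed.

End Tensor.

(* The vector library also exports a coord. *)
Local Notation coord := Defs.coord.

Section HilbertSum.
Variables (R : realType) (T : hilbertType R) (S : hilbert_sum T).

Lemma l2_coord (s : S) : l2 (coord s).
Proof.
apply/square_summableP.
have : range (@Defs.coord _ _ S) (coord s) by exists s.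
by rewrite coord_range.
Qed.

Lemma coord_surj (u : nat -> T) : l2 u -> exists s : S, coord s = u.
Proof.
move=> /square_summableP;
  rewrite -[square_summable u]/((@square_summable R T) u).
by rewrite -(coord_range S) => -[s _ <-]; exists s.
Qed.

Lemma rdot_coord (s t : S) : rdot s t = l2dot (coord s) (coord t).
Proof.
have /cvg_Re/(cvg_lim (@Rhausdorff R)) := @coord_dot _ _ S s t;
  rewrite /rdot => <-.
congr (limn _); apply/funext => n.
by rewrite Re_sum.
Qed.

Lemma coord_inj (s t : S) : coord s = coord t -> s = t.
Proof.
move=> st; apply/eqP; rewrite -subr_eq0; apply/eqP/rdot_eq0.
by rewrite rdotBl rdot_coord st -rdot_coord subrr.
Qed.

Lemma coord_bounded n : bounded_op (fun s : S => coord s n).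
Proof.
apply/bounded_opP; split; first by move=> a s t; rewrite coord_linear.
exists 1 => // s; rewrite mul1r rdot_coord; apply: l2_coord_le.
exact: l2_coord.
Qed.

Lemma coord_zero n : coord (0 : S) n = 0.
Proof. exact: (linear_zero (coord_bounded n).1). Qed.

Lemma amplification (f : T -> T) : bounded_op f ->
  exists2 F : S -> S, bounded_op F & forall s, coord (F s) = f \o coord s.
Proof.
move=> bf; have lf := bf.1.
have [F FE] := choice (fun s => coord_surj (l2_op bf (l2_coord s))).
exists F => //; apply/bounded_opP; split.
  move=> a s t; apply: coord_inj; rewrite coord_linear !FE coord_linear.
  by apply/funext => n; rewrite /= !fctE lf.
have [C C0 fC] := l2dot_op bf; exists C => // s.
by rewrite !rdot_coord FE; apply: fC; apply: l2_coord.
Qed.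

Lemma amplification_adjoint (f g : T -> T) (F G : S -> S) : radjoint f g ->
  (forall s, coord (F s) = f \o coord s) ->
  (forall s, coord (G s) = g \o coord s) -> radjoint F G.
Proof. by move=> fg FE GE s t; rewrite !rdot_coord FE GE; apply: l2dot_adj. Qed.

End HilbertSum.

(** * Pairs of vectors, the ambient space of the graph *)

Section Product.
Variables (R : realType) (H K : hilbertType R).
Implicit Types (A : set (H * K)) (p q : H * K).

(** [H * K] is normed by the maximum, so orthogonality has to come from this form; both give the
    same topology, by [closure_prodP]. *)
Definition pdot p q : R := rdot p.1 q.1 + rdot p.2 q.2.

Lemma pdot_inner_product : inner_product setT pdot.
Proof.
split; first by split.
- by move=> x y _ _; rewrite /pdot (rdotC x.1) (rdotC x.2).
- by move=> t x y z _ _ _; rewrite /pdot /= !rdotDl !rdotZl; ring.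
- by move=> a x y _ _; rewrite /pdot /= !rdotZ.
- by move=> x _; rewrite addr_ge0 ?rdot_ge0.
move=> [x y] _; rewrite /pdot /= => /eqP.
by rewrite paddr_eq0 ?rdot_ge0 // => /andP[/eqP/rdot_eq0 -> /eqP/rdot_eq0 ->].
Qed.

Lemma closure_prod_image (f : H -> H) (g : K -> K) A p :
  bounded_op f -> bounded_op g -> (forall a, A a -> A (f a.1, g a.2)) ->
  closure A p -> closure A (f p.1, g p.2).
Proof.
move=> /bounded_opP[lf [C C0 fC]] /bounded_opP[lg [D D0 gD]] fgA.
move=> /closure_prodP Ap; apply/closure_prodP => e e0.
have CD : 0 < C + D + 1 by rewrite ltr_pwDr // addr_ge0.
have [a Aa] := Ap _ (divr_gt0 e0 CD); rewrite ltr_pdivlMr // => ae.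
exists (f a.1, g a.2); first exact: fgA.
rewrite /= -!linear_sub //.
have := fC (p.1 - a.1); have := gD (p.2 - a.2).
have a1 := rdot_ge0 (p.1 - a.1); have a2 := rdot_ge0 (p.2 - a.2).
have := mulr_ge0 C0 a2; have := mulr_ge0 D0 a1.
lra.
Qed.

Lemma closure_prod_subspace A : is_subspace A -> is_subspace (closure A).
Proof.
move=> [A0 sA]; split; first exact: subset_closure.
move=> a x y Ax Ay.
have {}Ax : closure A (a *: x.1, a *: x.2).
  apply: closure_prod_image (bounded_scale H a) (bounded_scale K a) _ Ax.
  move=> z Az; have := sA a z 0 Az A0; rewrite addr0.
  by case: z {Az}.
move: Ax Ay => /closure_prodP Ax /closure_prodP Ay; apply/closure_prodP => e e0.
have e4 : 0 < e / 4 by rewrite divr_gt0.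
have [x' Ax' xx'] := Ax _ e4; have [y' Ay' yy'] := Ay _ e4.
exists (x' + y'); first by rewrite -[x']scale1r; apply: sA.
have -> : (a *: x + y).1 - (x' + y').1 = (a *: x.1 - x'.1) + (y.1 - y'.1).
  by rewrite /= opprD addrACA.
have -> : (a *: x + y).2 - (x' + y').2 = (a *: x.2 - x'.2) + (y.2 - y'.2).
  by rewrite /= opprD addrACA.
rewrite /= in xx'.
have := rdotD_le (a *: x.1 - x'.1) (y.1 - y'.1).
have := rdotD_le (a *: x.2 - x'.2) (y.2 - y'.2); lra.
Qed.

Lemma closure_prod_complete A : complete_in pdot (closure A).
Proof.
move=> s As cs.
have [|l1 sl1] := @rcauchy_cvg _ _ (fun n => (s n).1).
  move=> e /cs[N Ne]; exists N => m n Nm Nn.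
  apply: le_lt_trans (Ne m n Nm Nn).
  by rewrite lerDl rdot_ge0.
have [|l2 sl2] := @rcauchy_cvg _ _ (fun n => (s n).2).
  move=> e /cs[N Ne]; exists N => m n Nm Nn.
  apply: le_lt_trans (Ne m n Nm Nn).
  by rewrite lerDr rdot_ge0.
have sl : rcvg pdot s (l1, l2).
  move=> e e0; have e2 : 0 < e / 2 by rewrite divr_gt0.
  have [N1 N1e] := sl1 _ e2; have [N2 N2e] := sl2 _ e2.
  exists (maxn N1 N2) => n; rewrite geq_max => /andP[n1 n2].
  by rewrite /pdot /=; have := N1e n n1; have := N2e n n2; lra.
exists (l1, l2) => //.
rewrite [closure A](iffLR (closure_id _) (@closed_closure _ A)).
apply/closure_prodP => e /sl[N Ne]; exists (s N) => //; exact: Ne.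
Qed.

End Product.

(** * Bimodules over a tracial von Neumann algebra *)

Section Bimodule.
Variables (R : realType) (H : hilbertType R) (M : set (H -> H)).
Variables (tau : (H -> H) -> R[i]) (hM : von_neumann M).
Variables (htau : tracial_state M tau) (L : gns M tau).

Let sM : unital_star_subalgebra M M :=
  von_neumann_subalgebra hM (@subset_refl _ M).
Let M1 : M idfun := subalg_one sM.
Let MM x y : M x -> M y -> M (x \o y). Proof. exact: (subalg_mul sM). Qed.

Lemma vec_op_ext (X : hilbertType R) (f g : L -> X) : bounded_op f ->
  bounded_op g -> (forall z, M z -> f (vec L z) = g (vec L z)) -> f = g.
Proof.
move=> bf bg fg; apply/funext => u.
apply: (eq_closure bf bg (A := vec L @` M)); last by rewrite vec_dense.
by move=> _ [z Mz <-]; apply: fg.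
Qed.

Lemma lmul_id : lmul L idfun = idfun.
Proof.
apply: vec_op_ext; [exact: lmul_bounded|exact: bounded_id|].
by move=> z Mz; rewrite lmul_vec.
Qed.

Lemma rmul_id : rmul L idfun = idfun.
Proof.
apply: vec_op_ext; [exact: rmul_bounded|exact: bounded_id|].
by move=> z Mz; rewrite rmul_vec.
Qed.

Lemma lmul_rmul x y : M x -> M y -> lmul L x \o rmul L y = rmul L y \o lmul L x.
Proof.
move=> Mx My; have bx := lmul_bounded L Mx; have by_ := rmul_bounded L My.
apply: vec_op_ext; [exact: bounded_comp|exact: bounded_comp|].
move=> z Mz /=; rewrite (rmul_vec L My Mz) (lmul_vec L Mx Mz).
by rewrite (rmul_vec L My (MM Mx Mz)) (lmul_vec L Mx (MM Mz My)).
Qed.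

Lemma lmul_adjoint x x' : M x -> M x' -> adjoint x x' ->
  radjoint (lmul L x) (lmul L x').
Proof.
move=> Mx Mx' xx'.
apply: radjoint_dense (lmul_bounded L Mx) (lmul_bounded L Mx')
  (vec_dense L) (vec_dense L) _ => _ _ [y My <-] [z Mz <-].
have [z' Mz' zz'] := subalg_star sM Mz.
rewrite !lmul_vec // /rdot (vec_dot L (MM Mx My) Mz zz').
by rewrite (vec_dot L My (MM Mx' Mz) (adjoint_comp (adjointC xx') zz')).
Qed.

(** Unlike for [lmul], this rests on traciality: x has to be carried around the product inside
    tau. *)
Lemma rmul_adjoint x x' : M x -> M x' -> adjoint x x' ->
  radjoint (rmul L x) (rmul L x').
Proof.
move=> Mx Mx' xx'.
apply: radjoint_dense (rmul_bounded L Mx) (rmul_bounded L Mx')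
  (vec_dense L) (vec_dense L) _ => _ _ [y My <-] [z Mz <-].
have [z' Mz' zz'] := subalg_star sM Mz.
rewrite !rmul_vec // /rdot (vec_dot L (MM My Mx) Mz zz').
rewrite (vec_dot L My (MM Mz Mx') (adjoint_comp zz' (adjointC xx'))).
by rewrite -[(x \o z') \o y]/(x \o (z' \o y)) (trace_cyclic htau Mx (MM Mz'
  My)).
Qed.

(** tau(x^* x) = tau(x x^* ), so the adjoint is isometric for the L^2-norm and an approximation of x
    also approximates x^*. *)
Lemma vec_adjoint_norm x x' : M x -> M x' -> adjoint x x' ->
  rdot (vec L x') (vec L x') = rdot (vec L x) (vec L x).
Proof.
move=> Mx Mx' xx'; rewrite /rdot (vec_dot L Mx Mx xx').
by rewrite (vec_dot L Mx' Mx' (adjointC xx')) (trace_cyclic htau).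
Qed.

Lemma vecB x y : M x -> M y -> vec L (x - y) = vec L x - vec L y.
Proof.
by move=> Mx My; rewrite addrC -scaleN1r vec_linear // scaleN1r addrC.
Qed.

Lemma L2_subspace A : unital_star_subalgebra M A -> is_subspace (vec L @` A).
Proof.
move=> sA; have AM := subalg_sub sA; split.
  exists (idfun - idfun).
    by have := subalg_linear sA (-1) (subalg_one sA) (subalg_one sA);
      rewrite scaleN1r addrC.
  by rewrite vecB // subrr.
move=> a _ _ [x Ax <-] [y Ay <-]; exists (a *: x + y);
  first exact: (subalg_linear sA).
by rewrite vec_linear //; apply: AM.
Qed.

Section AdjointDensity.
Variables (A Q : set (H -> H)).
Hypothesis sA : unital_star_subalgebra M A.
Hypothesis QE : Q = smallest (@von_neumann R H) A.

Let QM : Q `<=` M.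
Proof. by rewrite QE; apply: smallest_sub => //; apply: subalg_sub sA. Qed.

(* An identity continuous in the vectors of x and of its adjoint passes from A
   to Q, although A need not approximate x in operator norm. *)
Lemma adjoint_density (X : hilbertType R) (f h : L -> X) (s t : X) :
  bounded_op f -> bounded_op h ->
  (forall a a', A a -> A a' -> adjoint a a' ->
     rdot (f (vec L a)) s = rdot t (h (vec L a'))) ->
  forall x x', Q x -> Q x' -> adjoint x x' ->
     rdot (f (vec L x)) s = rdot t (h (vec L x')).
Proof.
move=> /bounded_opP[lf [C C0 fC]] /bounded_opP[lh [D D0 hD]] fhA x x' Qx Qx'
  xx'.
pose phi (p : L * L) := rdot (f p.1) s - rdot t (h p.2).
apply/eqP; rewrite -subr_eq0; apply/eqP.
pose E := [set p : L * L | exists a a',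
  [/\ A a, A a', adjoint a a' & p = (vec L a, vec L a')]].
apply: (@functional_approx _ _ (fun p => pdot p p) phi E (vec L x, vec L x')).
- by move=> p; rewrite addr_ge0 ?rdot_ge0.
- by move=> p q; rewrite /phi /= !linear_sub // rdotBl rdotBr; ring.
- exists (2 * (C * rdot s s) + 2 * (D * rdot t t)) => p.
  have := rdot_CauchySchwarz (f p.1) s; have := rdot_CauchySchwarz t (h p.2).
  have s0 := rdot_ge0 s; have t0 := rdot_ge0 t.
  have := ler_wpM2r s0 (fC p.1); have := ler_wpM2l t0 (hD p.2).
  have p1 := rdot_ge0 p.1; have p2 := rdot_ge0 p.2.
  have := mulr_ge0 (mulr_ge0 C0 s0) p2; have := mulr_ge0 (mulr_ge0 D0 t0) p1.
  have := sqr_ge0 (rdot (f p.1) s + rdot t (h p.2)).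
  rewrite /phi /pdot; move: (rdot (f p.1) s) (rdot t (h p.2)) => a b.
  have : (a - b) ^+ 2 + (a + b) ^+ 2 = 2 * a ^+ 2 + 2 * b ^+ 2 by ring.
  lra.
- by move=> _ [a [a' [Aa Aa' aa' ->]]]; rewrite /phi /= (fhA a a') // subrr.
move=> e e0; have e2 : 0 < e / 2 by rewrite divr_gt0.
have Nx : smallest (@von_neumann R H) A x by rewrite -QE.
have /closureP/(_ _ e2)[_ [a Aa <-] ae] :=
  vec_dense_smallest hM htau (L := L) sA Nx.
have [a' Aa' aa'] := subalg_star sA Aa; have AM := subalg_sub sA.
have Ma := AM _ Aa; have Ma' := AM _ Aa'; have Mx := QM Qx; have Mx' := QM Qx'.
(* One approximation [a] of [x] serves both components: x' - a' is the adjoint of x - a and has the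
   same L^2-norm, so each contributes less than e / 2. *)
exists (vec L a, vec L a'); first by exists a, a'.
have MB u v : M u -> M v -> M (u - v).
  by move=> Mu Mv; have := subalg_linear sM (-1) Mv Mu; rewrite scaleN1r addrC.
move: ae; rewrite /pdot /= -!vecB // => ae.
by rewrite (vec_adjoint_norm (MB _ _ Mx Ma) (MB _ _ Mx' Ma') (adjointB xx'
  aa')); lra.
Qed.

End AdjointDensity.
End Bimodule.

(** * The derivation and the star-algebra in its kernel *)

Section Anticoarse.
Variables (R : realType) (H : hilbertType R) (M : set (H -> H)).
Variables (tau : (H -> H) -> R[i]).
Variables (hM : von_neumann M) (htau : tracial_state M tau).
Variables (L : gns M tau) (LL : hilbert_tensor L L) (S : hilbert_sum LL).
Variables (dom : set (H -> H)) (delta : (H -> H) -> S).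
Variables (hdom : unital_star_subalgebra M dom) (hdelta : derivation dom delta).

Let sM : unital_star_subalgebra M M :=
  von_neumann_subalgebra hM (@subset_refl _ M).
Let M1 : M idfun := subalg_one sM.
Let domM x : dom x -> M x. Proof. exact: (subalg_sub hdom). Qed.
Let dom1 : dom idfun := subalg_one hdom.

Let blm x : M x -> bounded_op (lmul L x). Proof. exact: lmul_bounded. Qed.
Let brm x : M x -> bounded_op (rmul L x). Proof. exact: rmul_bounded. Qed.

Lemma bimul_bounded x y : M x -> M y -> bounded_op (bimul (LL := LL) x y).
Proof. by move=> Mx My; apply: top_bounded; [exact: blm|exact: brm]. Qed.

Lemma bimul_lr x y : M x -> M y -> bimul (LL := LL) x y =
  bimul (LL := LL) x idfun \o bimul (LL := LL) idfun y.
Proof.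
move=> Mx My; have bx := blm Mx; have by_ := brm My.
have b1 := bounded_id L.
by rewrite /bimul lmul_id // rmul_id // -top_comp.
Qed.

Lemma bimul_adjoint x x' y y' : M x -> M x' -> M y -> M y' ->
  adjoint x x' -> adjoint y y' ->
  radjoint (bimul (LL := LL) x y) (bimul (LL := LL) x' y').
Proof.
move=> Mx Mx' My My' xx' yy'.
by apply: top_adjoint;
  [exact: blm|exact: blm|exact: brm|exact: brm
  |exact: lmul_adjoint|exact: rmul_adjoint].
Qed.

Lemma bimul_id t : bimul (LL := LL) idfun idfun t = t.
Proof. by rewrite /bimul lmul_id // rmul_id // top_id. Qed.

Let A0 := deriv_ker dom delta `&` deriv_ker_star dom delta.

Lemma delta_id : delta idfun = 0.
Proof.
apply: coord_inj; apply/funext => n.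
have := deriv_leibniz hdelta dom1 dom1 n; rewrite !bimul_id.
by rewrite -[_ \o _]/(@idfun H) -[LHS]addr0 => /addrI <-; rewrite coord_zero.
Qed.

(** The Leibniz rule makes the kernel an algebra; the intersection with its adjoint makes it stable
    under adjoints. *)
Lemma deriv_ker_subalgebra : unital_star_subalgebra M A0.
Proof.
have kerM x y : deriv_ker dom delta x -> deriv_ker dom delta y ->
    deriv_ker dom delta (x \o y).
  move=> [dx x0] [dy y0]; split; first exact: (subalg_mul hdom).
  apply: coord_inj; apply/funext => n;
    rewrite (deriv_leibniz hdelta) // x0 y0 coord_zero.
  have [l1 _] := bimul_bounded M1 (domM dy);
    have [l2 _] := bimul_bounded (domM dx) M1.
  by rewrite (linear_zero l1) (linear_zero l2) addr0.
have kerL a x y : deriv_ker dom delta x -> deriv_ker dom delta y ->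
    deriv_ker dom delta (a *: x + y).
  move=> [dx x0] [dy y0]; split; first exact: (subalg_linear hdom).
  by rewrite (deriv_linear hdelta) // x0 y0 scaler0 addr0.
split.
- by move=> x [[/domM]].
- split; first by split=> //; apply: delta_id.
  by exists idfun => //; split=> //; apply: delta_id.
- move=> a x y [kx [x' kx' xx']] [ky [y' ky' yy']]; split; first exact: kerL.
  exists (Num.conj a *: x' + y'); first exact: kerL.
  by apply: adjointC; apply: adjoint_linear; apply: adjointC.
- move=> x y [kx [x' kx' xx']] [ky [y' ky' yy']]; split; first exact: kerM.
  by exists (y' \o x'); [exact: kerM|exact: adjoint_comp].
move=> x [kx [x' kx' xx']]; exists x'; last exact: adjointC.
by split=> //; exists x => //; apply: adjointC.
Qed.

(** * The orthogonal projection onto the closed graph *)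

Section Projection.
Variable P : L * S -> L * S.
Hypothesis PP : is_projection setT (@pdot R L S) (closed_graph dom delta L) P.

Let graph := [set p : L * S | exists2 x, dom x & p = (vec L x, delta x)].

Lemma graph_subspace : is_subspace graph.
Proof.
split.
  exists (idfun - idfun).
    by have := subalg_linear hdom (-1) dom1 dom1; rewrite scaleN1r addrC.
  have d0 : delta (idfun - idfun) = 0.
    by have := deriv_linear hdelta (-1) dom1 dom1;
      rewrite !scaleN1r addrC addNr.
  by congr pair; rewrite ?d0 // (vecB L M1 M1) subrr.
move=> a _ _ [x dx ->] [y dy ->]; exists (a *: x + y).
  exact: (subalg_linear hdom).
by rewrite (deriv_linear hdelta) // (vec_linear L) //; apply: domM.
Qed.

Let sG := closure_prod_subspace graph_subspace.

(** If the closure T of [delta] is an operator, this is T(1 + T^*T)^{-1} on the closure of the image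
    of [dom] and 0 on its orthogonal complement. *)
Definition deriv_proj xi := (P (xi, 0)).2.

Lemma deriv_proj_bounded : bounded_op deriv_proj.
Proof.
have pl := proj_linear (pdot_inner_product L S) sG (@subsetT _ _) PP.
apply/bounded_opP; split.
  move=> a x y; rewrite /deriv_proj.
  by have := pl a (x, 0) (y, 0) I I => /(congr1 snd) /= <-;
    congr (snd (P (_, _))); rewrite /= scaler0 addr0.
exists 1 => // u; rewrite mul1r.
have := proj_le (pdot_inner_product L S) sG (@subsetT _ _) PP (u := (u, 0)) I.
rewrite /pdot /= rdot0l addr0; apply: le_trans.
by rewrite lerDr rdot_ge0.
Qed.

(** U together with V in each coordinate preserves the graph, and so does its adjoint. The closed
    graph therefore reduces it, and it commutes with the projection. *)
Lemma deriv_proj_comm (U U' : L -> L) (V V' : LL -> LL) :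
  bounded_op U -> bounded_op U' -> bounded_op V -> bounded_op V' ->
  radjoint U U' -> radjoint V V' ->
  (forall x, dom x -> exists2 y, dom y & U (vec L x) = vec L y /\
     coord (delta y) = V \o coord (delta x)) ->
  (forall x, dom x -> exists2 y, dom y & U' (vec L x) = vec L y /\
     coord (delta y) = V' \o coord (delta x)) ->
  forall xi, coord (deriv_proj (U xi)) = V \o coord (deriv_proj xi).
Proof.
move=> bU bU' bV bV' UU' VV' UV UV' xi.
have [W bW WE] := amplification S bV; have [W' bW' WE'] := amplification S bV'.
have WW' := amplification_adjoint VV' WE WE'.
pose f (p : L * S) := (U p.1, W p.2); pose f' (p : L * S) := (U' p.1, W' p.2).
have gf p : closed_graph dom delta L p -> closed_graph dom delta L (f p).
  apply: closure_prod_image => // _ [x dx ->] /=.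
  have [y dy [-> yx]] := UV x dx; exists y => //.
  by congr pair; apply: coord_inj; rewrite WE yx.
have gf' p : closed_graph dom delta L p -> closed_graph dom delta L (f' p).
  apply: closure_prod_image => // _ [x dx ->] /=.
  have [y dy [-> yx]] := UV' x dx; exists y => //.
  by congr pair; apply: coord_inj; rewrite WE' yx.
have fB x y : f (x - y) = f x - f y.
  by rewrite /f /= (linear_sub _ _ bU.1) (linear_sub _ _ bW.1).
have ff' x y : pdot (f x) y = pdot x (f' y) by rewrite /pdot /f /f' /= UU' WW'.
have E := proj_comm (pdot_inner_product L S) sG (@subsetT _ _) PP
  (fun x y _ _ => fB x y) (fun _ _ => I) (fun x y _ _ => ff' x y) gf gf'
  (I : setT (xi, 0)).
have f0 : (U xi, 0) = f (xi, 0) by rewrite /f /= (linear_zero bW.1).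
by rewrite /deriv_proj f0 E WE.
Qed.

(** As delta(a) = 0, the Leibniz rule reads delta(a y) = a . delta(y), so left multiplication by a
    preserves the graph; the same holds for the adjoint of a. *)
Lemma deriv_proj_lmul a xi : A0 a ->
  coord (deriv_proj (lmul L a xi)) =
  bimul (LL := LL) a idfun \o coord (deriv_proj xi).
Proof.
have lker x : deriv_ker dom delta x -> forall y, dom y -> exists2 z, dom z &
    lmul L x (vec L y) = vec L z /\
    coord (delta z) = bimul (LL := LL) x idfun \o coord (delta y).
  move=> [dx x0] y dy; exists (x \o y); first exact: (subalg_mul hdom).
  split; first by rewrite lmul_vec //; apply: domM.
  apply/funext => n; rewrite (deriv_leibniz hdelta) // x0 coord_zero.
  by rewrite (linear_zero (bimul_bounded M1 (domM dy)).1) add0r.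
move=> [ka [a' ka' aa']]; have Ma := domM ka.1; have Ma' := domM ka'.1.
apply: (deriv_proj_comm (U' := lmul L a') (V' := bimul (LL := LL) a' idfun)).
- exact: blm.
- exact: blm.
- exact: bimul_bounded.
- exact: bimul_bounded.
- by apply: lmul_adjoint => //; apply: adjointC.
- by apply: bimul_adjoint => //; apply: adjointC.
- exact: lker.
- exact: lker.
Qed.

Lemma deriv_proj_rmul a xi : A0 a ->
  coord (deriv_proj (rmul L a xi)) =
  bimul (LL := LL) idfun a \o coord (deriv_proj xi).
Proof.
have rker x : deriv_ker dom delta x -> forall y, dom y -> exists2 z, dom z &
    rmul L x (vec L y) = vec L z /\
    coord (delta z) = bimul (LL := LL) idfun x \o coord (delta y).
  move=> [dx x0] y dy; exists (y \o x); first exact: (subalg_mul hdom).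
  split; first by rewrite rmul_vec //; apply: domM.
  apply/funext => n; rewrite (deriv_leibniz hdelta) // x0 coord_zero.
  by rewrite (linear_zero (bimul_bounded (domM dy) M1).1) addr0.
move=> [ka [a' ka' aa']]; have Ma := domM ka.1; have Ma' := domM ka'.1.
apply: (deriv_proj_comm (U' := rmul L a') (V' := bimul (LL := LL) idfun a')).
- exact: brm.
- exact: brm.
- exact: bimul_bounded.
- exact: bimul_bounded.
- by apply: rmul_adjoint => //; apply: adjointC.
- by apply: bimul_adjoint => //; apply: adjointC.
- exact: rker.
- exact: rker.
Qed.

(** * Bimodularity over the generated algebra Q *)

Section Generated.
Variable Q : set (H -> H).
Hypothesis QE : Q = smallest (@von_neumann R H) A0.

Let QM : Q `<=` M.
Proof. by rewrite QE; apply: smallest_sub => // x [[/domM]]. Qed.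

Let vQ : von_neumann Q.
Proof. by rewrite QE; apply: smallest_von_neumann hM _ => x [[/domM]]. Qed.

Let sQ : unital_star_subalgebra M Q := von_neumann_subalgebra vQ QM.

Let adjoint_id : adjoint (@idfun H) idfun. Proof. by []. Qed.

Let bf n : bounded_op (fun xi => coord (deriv_proj xi) n).
Proof. exact: (bounded_comp (coord_bounded S n) deriv_proj_bounded). Qed.

(** The identity is tested on [vec L z] and against [tens LL (vec L m) (vec L m')]. There x z is the
    bounded map [rmul L z] applied to the vector of x, and the adjoint of x, moved onto the tensor,
    enters through [rmul L m] applied to the vector of x'. Thus only the vectors of x and x' occur,
    and [adjoint_density] applies. *)
Lemma deriv_proj_lmul_gen x xi n : Q x ->
  coord (deriv_proj (lmul L x xi)) n = bimul x idfun (coord (deriv_proj xi) n).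
Proof.
move=> Qx; have Mx := QM Qx; have [x' Qx' xx'] := subalg_star sQ Qx.
have Mx' := QM Qx'; have bx := bimul_bounded Mx M1.
pose f := fun xi => coord (deriv_proj xi) n.
suff : f \o lmul L x = bimul (LL := LL) x idfun \o f.
  by move=> /(congr1 (fun g => g xi)).
apply: vec_op_ext => [||z Mz].
- by apply: bounded_comp (bf n) _; apply: blm.
- exact: bounded_comp bx (bf n).
apply/eqP; rewrite -subr_eq0; apply/eqP.
apply: (tensor_orth (vec_dense L) (vec_dense L)) => _ _ [m Mm <-] [m' Mm' <-].
have tensE a : M a -> bimul (LL := LL) a idfun (tens LL (vec L m) (vec L m')) =
    tens LL (rmul L m (vec L a)) (vec L m').
  move=> Ma; rewrite /bimul top_tens; [|exact: blm|exact: brm].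
  by rewrite rmul_id // lmul_vec // rmul_vec.
rewrite rdotBl /= (bimul_adjoint Mx Mx' M1 M1 xx' adjoint_id) tensE //.
rewrite lmul_vec // -rmul_vec //; apply/eqP; rewrite subr_eq0; apply/eqP.
apply: (adjoint_density hM htau deriv_ker_subalgebra QE (f := f \o rmul L z)
  (h := fun zeta => tens LL (rmul L m zeta) (vec L m'))) Qx Qx' xx'.
- by apply: bounded_comp (bf n) _; apply: brm.
- by apply: (bounded_comp (tens_boundedl _ _)); apply: brm.
move=> a a' Aa Aa' aa'; have Ma := domM Aa.1.1; have Ma' := domM Aa'.1.1.
rewrite /= rmul_vec // -lmul_vec // /f deriv_proj_lmul //.
by rewrite -tensE // -(bimul_adjoint Ma Ma' M1 M1 aa' adjoint_id).
Qed.

(** Mirror image: z x is [lmul L z] applied to the vector of x, and the second tensor leg carries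
    the adjoint. *)
Lemma deriv_proj_rmul_gen x xi n : Q x ->
  coord (deriv_proj (rmul L x xi)) n = bimul idfun x (coord (deriv_proj xi) n).
Proof.
move=> Qx; have Mx := QM Qx; have [x' Qx' xx'] := subalg_star sQ Qx.
have Mx' := QM Qx'; have bx := bimul_bounded M1 Mx.
pose f := fun xi => coord (deriv_proj xi) n.
suff : f \o rmul L x = bimul (LL := LL) idfun x \o f.
  by move=> /(congr1 (fun g => g xi)).
apply: vec_op_ext => [||z Mz].
- by apply: bounded_comp (bf n) _; apply: brm.
- exact: bounded_comp bx (bf n).
apply/eqP; rewrite -subr_eq0; apply/eqP.
apply: (tensor_orth (vec_dense L) (vec_dense L)) => _ _ [m Mm <-] [m' Mm' <-].
have tensE a : M a -> bimul (LL := LL) idfun a (tens LL (vec L m) (vec L m')) =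
    tens LL (vec L m) (lmul L m' (vec L a)).
  move=> Ma; rewrite /bimul top_tens; [|exact: blm|exact: brm].
  by rewrite lmul_id // lmul_vec // rmul_vec.
rewrite rdotBl /= (bimul_adjoint M1 M1 Mx Mx' adjoint_id xx') tensE //.
rewrite rmul_vec // -lmul_vec //; apply/eqP; rewrite subr_eq0; apply/eqP.
apply: (adjoint_density hM htau deriv_ker_subalgebra QE (f := f \o lmul L z)
  (h := fun zeta => tens LL (vec L m) (lmul L m' zeta))) Qx Qx' xx'.
- by apply: bounded_comp (bf n) _; apply: blm.
- by apply: (bounded_comp (tens_boundedr _ _)); apply: blm.
move=> a a' Aa Aa' aa'; have Ma := domM Aa.1.1; have Ma' := domM Aa'.1.1.
rewrite /= lmul_vec // -rmul_vec // /f deriv_proj_rmul //.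
by rewrite -tensE // -(bimul_adjoint M1 M1 Ma Ma' adjoint_id aa').
Qed.

(** * Compression of tensors over M to tensors over Q *)

Section Compression.
Variables (E : L -> L) (m m' : H -> H) (n : nat).
Hypotheses (EP : is_projection setT (@rdot R L) (L2 (L := L) Q) E).
Hypotheses (bE : bounded_op E).
Hypotheses (Mm : M m) (Mm' : M m').

Let EU U U' : bounded_op U -> bounded_op U' -> radjoint U U' ->
  (forall x, Q x -> L2 (L := L) Q (U (vec L x))) ->
  (forall x, Q x -> L2 (L := L) Q (U' (vec L x))) ->
  E \o U = U \o E.
Proof.
move=> bU bU' UU' UQ UQ'; apply/funext => xi.
have stable V : bounded_op V ->
    (forall x, Q x -> L2 (L := L) Q (V (vec L x))) ->
    forall w, L2 (L := L) Q w -> L2 (L := L) Q (V w).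
  by move=> bV VQ w; apply: closure_image bV _ => _ [x Qx <-]; apply: VQ.
apply: (@proj_comm _ _ _ _ (rdot_inner_product L) _ E
  (closure_subspace (L2_subspace hM L sQ)) (@subsetT _ _) EP U U' xi) => //.
- by move=> x y _ _; apply: linear_sub bU.1.
- exact: stable.
- exact: stable.
Qed.

Lemma compression_lmul x : Q x -> E \o lmul L x = lmul L x \o E.
Proof.
move=> Qx; have [x' Qx' xx'] := subalg_star sQ Qx.
have lQ y z : Q y -> Q z -> L2 (L := L) Q (lmul L y (vec L z)).
  move=> Qy Qz; apply: subset_closure; exists (y \o z);
    first exact: (subalg_mul sQ).
  by rewrite lmul_vec //; apply: QM.
apply: (EU (U' := lmul L x')); [exact: blm (QM _)|exact: blm (QM _)| | |].
- exact: lmul_adjoint (QM Qx) (QM Qx') xx'.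
- by move=> z; apply: lQ.
- by move=> z; apply: lQ.
Qed.

Lemma compression_rmul x : Q x -> E \o rmul L x = rmul L x \o E.
Proof.
move=> Qx; have [x' Qx' xx'] := subalg_star sQ Qx.
have rQ y z : Q y -> Q z -> L2 (L := L) Q (rmul L y (vec L z)).
  move=> Qy Qz; apply: subset_closure; exists (z \o y);
    first exact: (subalg_mul sQ).
  by rewrite rmul_vec //; apply: QM.
apply: (EU (U' := rmul L x')); [exact: brm (QM _)|exact: brm (QM _)| | |].
- exact: rmul_adjoint (QM Qx) (QM Qx') xx'.
- by move=> z; apply: rQ.
- by move=> z; apply: rQ.
Qed.

Let bEm : bounded_op (E \o rmul L m).
Proof. by apply: bounded_comp bE _; apply: brm. Qed.

Let bEm' : bounded_op (E \o lmul L m').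
Proof. by apply: bounded_comp bE _; apply: blm. Qed.

(** [m] and [m'] multiply on the inner sides of the two legs, so they commute with the outer actions
    of Q, as does [E]. *)
Definition compression : LL -> LL := top LL (E \o rmul L m) (E \o lmul L m').

Lemma compression_bounded : bounded_op compression.
Proof. exact: top_bounded. Qed.

Lemma compression_range t : L2tens (LL := LL) Q (compression t).
Proof.
have bC := compression_bounded.
apply: (closure_image bC (A := tensor_sums (tens LL) setT setT)); last first.
  by rewrite tens_dense.
move=> _ [k [a [b [_ ->]]]]; apply: subset_closure.
exists k, (fun i => E (rmul L m (a i))), (fun i => E (lmul L m' (b i))); split.
  by move=> i; split; apply: (proj_in EP).
rewrite (big_morph _ (fun u v => linear_add u v bC.1) (linear_zero bC.1)).
by apply: eq_bigr => i _; rewrite /compression top_tens.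
Qed.

Lemma compression_bimul x y : Q x -> Q y ->
  compression \o bimul (LL := LL) x y = bimul (LL := LL) x y \o compression.
Proof.
move=> Qx Qy; have Mx := QM Qx; have My := QM Qy.
have bx := blm Mx; have by_ := brm My.
rewrite /compression /bimul -!top_comp //; congr (top LL _ _).
  rewrite -[LHS]/(E \o (rmul L m \o lmul L x)) -lmul_rmul //.
  by rewrite -[LHS]/((E \o lmul L x) \o rmul L m) compression_lmul.
rewrite -[LHS]/(E \o (lmul L m' \o rmul L y)) lmul_rmul //.
by rewrite -[LHS]/((E \o rmul L y) \o lmul L m') compression_rmul.
Qed.

Lemma compression_bimodular N :
  bimodular_map Q N (fun xi => compression (coord (deriv_proj xi) n)).
Proof.
have bF := bounded_comp compression_bounded (bf n).
split.
- by move=> a xi eta _ _; apply: bF.1.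
- by have [t _ tP] := bounded_op_norm bF; exists t%:C => xi _; apply: tP.
- by move=> xi _; apply: compression_range.
move=> x y xi Qx Qy _; rewrite deriv_proj_lmul_gen // deriv_proj_rmul_gen //.
have -> : bimul x idfun (bimul idfun y (coord (deriv_proj xi) n)) =
    bimul x y (coord (deriv_proj xi) n).
  by rewrite [in RHS]bimul_lr //; apply: QM.
by have /(congr1 (fun g =>
  g (coord (deriv_proj xi) n))) := compression_bimul Qx Qy.
Qed.

(** [E] is self-adjoint and fixes the vector of 1, so 1 (x) 1 is carried to the adjoints of m and
    m'. Letting these vary, the compressions separate the points of [LL] by [tensor_orth]. *)
Lemma compression_pairing t mm mm' : adjoint m mm -> adjoint m' mm' ->
  M mm -> M mm' -> rdot (compression t) (tens LL (vec L idfun) (vec L idfun)) =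
  rdot t (tens LL (vec L mm) (vec L mm')).
Proof.
move=> mmm mmm' Mmm Mmm'.
have symE : radjoint E E.
  move=> u v; exact: (proj_sym (rdot_inner_product L) (@subsetT _ _) EP).
have E1 : E (vec L idfun) = vec L idfun.
  apply: (proj_id (rdot_inner_product L)
    (closure_subspace (L2_subspace hM L sQ)) (@subsetT _ _) EP).
  by apply: subset_closure; exists idfun => //; exact: (subalg_one sQ).
have adjE U U' : radjoint U U' -> radjoint (E \o U) (U' \o E).
  by move=> UU' u v /=; rewrite symE UU'.
have bmm := brm Mmm; have bmm' := blm Mmm'.
rewrite /compression.
rewrite (top_adjoint (A' := rmul L mm \o E) (B' := lmul L mm' \o E)) //.
- rewrite top_tens /= ?E1; last 2 first.
  - exact: bounded_comp.
  - exact: bounded_comp.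
  by rewrite lmul_vec // rmul_vec.
- exact: bounded_comp.
- exact: bounded_comp.
- by apply: adjE; apply: rmul_adjoint.
- by apply: adjE; apply: lmul_adjoint.
Qed.

End Compression.
End Generated.
End Projection.
End Anticoarse.

(** * Anticoarse vectors in the kernel of the closure *)

Theorem proposition2 (R : realType) (H : hilbertType R) (M : set (H -> H))
    (tau : (H -> H) -> R[i]) (hM : von_neumann M) (htau : tracial_state M tau)
    (L : gns M tau) (LL : hilbert_tensor L L) (S : hilbert_sum LL)
    (dom : set (H -> H)) (delta : (H -> H) -> S)
    (hdom : unital_star_subalgebra M dom) (hdelta : derivation dom delta)
    (Q N : set (H -> H))
    (hQ : Q = smallest (@von_neumann R H)
                (deriv_ker dom delta `&` deriv_ker_star dom delta))
    (hN : N = smallest (@von_neumann R H) dom)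
    (hclosable : closable dom delta L) :
  anticoarse LL Q N `<=` closure_ker dom delta L.
Proof.
move=> xi [L2Nxi kill].
have domM : dom `<=` M := subalg_sub hdom.
have QM : Q `<=` M.
  by rewrite hQ; apply: smallest_sub => // x [[/domM]].
have vQ : von_neumann Q.
  by rewrite hQ; apply: (smallest_von_neumann hM) => x [[/domM]].
have sQ := von_neumann_subalgebra vQ QM.
have M1 := QM _ (subalg_one sQ).
have [_ starM _] := hM.
have [P PP] := projection_op (pdot_inner_product L S)
  (closure_prod_subspace (graph_subspace hM hdom hdelta)) (@subsetT _ _)
  (@closure_prod_complete _ _ _ _).
have [E EP bE] := closed_projection (L2_subspace hM L sQ).
have B0 : deriv_proj P xi = 0.
  apply: coord_inj; apply/funext => n; rewrite coord_zero.
  apply: (tensor_orth (vec_dense L) (vec_dense L)) => _ _ [m Mm <-] [m' Mm' <-].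
  (* The compression is taken at the adjoints, so that [compression_pairing] returns [m] and
     [m']. *)
  have [s Ms ms] := starM _ Mm; have [s' Ms' ms'] := starM _ Mm'.
  rewrite -(compression_pairing hM htau hdom hQ EP bE Ms Ms' _
    (adjointC ms) (adjointC ms')) //.
  by rewrite (kill _ (compression_bimodular hM htau hdom hdelta PP hQ n EP bE
    Ms Ms' N)) rdot0l.
have [GP orthP] := PP (xi, 0) I.
set eta := (P (xi, 0)).1.
have PE : P (xi, 0) = (eta, 0).
  by rewrite [LHS]surjective_pairing -/(deriv_proj P xi) B0.
(* Since (xi - eta, 0) has no second component, its pairing with (vec x, delta x) does not see delta
   x. *)
have orth x : dom x -> rdot (xi - eta) (vec L x) = 0.
  move=> dx; have := orthP (vec L x, delta x).
  rewrite PE /pdot /= subrr rdot0l addr0; apply.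
  by apply: subset_closure; exists x.
(* [xi] lies there because [dom] is L^2-dense in N, and [eta] because it is the first component of a
   limit of the graph. *)
have closed_dom : closure (vec L @` dom) (xi - eta).
  apply: (is_subspaceB (closure_subspace (L2_subspace hM L hdom))).
    apply: (closure_image (bounded_id L) _ L2Nxi) => _ [x Nx <-].
    by apply: (vec_dense_smallest hM htau hdom); rewrite -hN.
  apply/closureP => e e0; have /closure_prodP/(_ e e0)[_ [x dx ->] /= xe] := GP.
  exists (vec L x); first by exists x.
  by apply: le_lt_trans xe; rewrite lerDl rdot_ge0.
have xiE : xi = eta.
  apply/eqP; rewrite -subr_eq0; apply/eqP/rdot_eq0.
  by apply: orth_closure closed_dom => _ [x dx <-]; apply: orth.
by rewrite /closure_ker /= {1}xiE -PE.
Qed.
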